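(* Let $b\ge 2$, let $(\bar\xi_{ij})_{i,j=1}^b$ be positive random variables, and let $T$ be the $b$-ary rooted tree with vertex set $\mathbb V$, random colouring $c$, edge variables $\zeta_{uv}$ and path products $\zeta[v]$ as described in the context. Let $\mathsf Y=\sum_{v\in\mathbb V}\zeta[v]$ and $\lambda_1=\inf_{s\in[0,1]}\rho(s)$, where $\rho(s)$ is the largest eigenvalue of the matrix $m(s)=\big(\mathbb E\,\bar\xi_{ij}^{\,s}\big)_{i,j=1}^b$. (a) If $\lambda_1<1$, then $\mathsf Y<\infty$ almost surely. (b) Let $\mathbb D=\{s\in\mathbb R:\ \mathbb E\,\bar\xi_{ij}^{\,s}<\infty\ \text{for all } i,j\in\{1,\dots,b\}\}$. If $\lambda_1>1$ and if $[0,1]\subseteq\mathbb D$, $0$ is an interior point of $\mathbb D$, and $\mathbb E|\log\bar\xi_{ij}|<\infty$ and $\mathbb E|\bar\xi_{ij}\log\bar\xi_{ij}|<\infty$ for all $i,j\in\{1,\dots,b\}$, then $\mathsf Y=\infty$ almost surely.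
   Context: Tree. Let $T$ be the infinite rooted tree with root $v_0$ in which every vertex has exactly $b\ge2$ children; $\mathbb V$ is its vertex set and $\mathbb V_n$ the set of the $b^n$ vertices at distance $n$ from the root. Random colouring. Each vertex $v$ gets a colour $c(v)\in\{1,\dots,b\}$. The root has an arbitrary fixed colour. Recursively for $n\ge1$, given the colours up to level $n-1$, the vertices of $\mathbb V_n$ are coloured uniformly at random among the $(b!)^{b^{n-1}}$ colourings in which children of the same parent have different colours, independently of the previous levels. Edge variables. Let $(\bar\xi_{ij})_{i,j=1}^b$ be positive random variables with given joint distribution. Conditionally on the colouring, assign to each edge joining a parent $u$ to its child $v$ a random variable $\zeta_{uv}=\zeta_{vu}$ with the law of $\bar\xi_{c(u)c(v)}$, such that: the families $(\zeta_{uv})_{v\text{ child of }u}$, $u\in\mathbb V$, are independent of each other; and for a vertex $u$ of colour $i$ the family $(\zeta_{uv})_{v\text{ child of }u}$, with children ordered by colour, has the law of $(\bar\xi_{i1},\dots,\bar\xi_{ib})$. (Variables on sibling edges may be dependent.) Path products. $\zeta[v]$ is the product of the variables assigned to the edges of the path from $v_0$ to $v$; $\zeta[v_0]=1$. Matrix. For $s\in[0,\infty)$, $m(s)$ is the $b\times b$ matrix with entries $\mathbb E\,\bar\xi_{ij}^{\,s}$ and $\rho(s)>0$ is its largest (Perron–Frobenius) eigenvalue, with $\rho(s)=+\infty$ if some entry is infinite. Almost sure statements refer to the joint law of the colouring and the edge variables. *)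

(* Defs.v *)
From mathcomp Require Import all_boot all_order all_algebra.
From mathcomp Require Import all_classical all_reals all_analysis.

Set Implicit Arguments.
Unset Strict Implicit.
Unset Printing Implicit Defensive.

Import Order.TTheory GRing.Theory Num.Theory.
Import numFieldNormedType.Exports.

Local Open Scope classical_set_scope.
Local Open Scope ring_scope.

(* A vertex of the b-ary tree is the word of the child indices met on the way
   down from the root [::]; the children of u are the words rcons u k.
   Level n consists of the words of size n. *)
Notation vertex b := (seq 'I_b).

Definition child (b : nat) (u : vertex b) (k : 'I_b) : vertex b := rcons u k.

Definition proper_level (b : nat) (n : nat) (kappa : vertex b -> 'I_b) : Prop :=
  forall u : vertex b, size u = n -> injective (fun k => kappa (child u k)).

Definition agree_upto (b : nat) (T : Type) (c : vertex b -> T -> 'I_b)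
    (kappa : vertex b -> 'I_b) (n : nat) : set T :=
  [set w | forall u : vertex b, (size u <= n)%N -> c u w = kappa u].

(* The recursive law of the colouring, in terms of joint probabilities: the
   colours of level n.+1 are independent of the levels up to n and uniform
   among the (b!)^(b^n) proper colourings of that level. *)
Record random_colouring (d : measure_display) (Omega : measurableType d)
    (R : realType) (P : probability Omega R) (b : nat) (c0 : 'I_b)
    (c : vertex b -> Omega -> 'I_b) : Prop := RandomColouring {
  colour_measurable : forall u i, measurable (c u @^-1` [set i]);
  colour_root : forall w, c [::] w = c0;
  colour_step : forall (n : nat) (kappa : vertex b -> 'I_b),
    P (agree_upto c kappa n.+1) =
    (P (agree_upto c kappa n) *
     (if `[< proper_level n kappa >]
      then ((b`! ^ (b ^ n))%:R^-1)%:E else 0))%E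
}.

Definition colour_algebra (b : nat) (T : Type) (c : vertex b -> T -> 'I_b) :
    set (set T) :=
  <<s [set A | exists u i, A = c u @^-1` [set i]] >>.

(* The index of the child of u that has colour j. The default value is only
   used if no child has colour j, which happens with probability 0. *)
Definition child_of_colour (b : nat) (kappa : vertex b -> 'I_b) (u : vertex b)
    (j : 'I_b) : 'I_b :=
  odflt j [pick k | kappa (child u k) == j].

(* An edge is named by its lower endpoint: zeta v is the variable on the edge
   from the parent of v to v, and zeta [::] plays no role. *)
Definition edges_by_colour (b : nat) (R : realType) (T : Type)
    (c : vertex b -> T -> 'I_b) (zeta : vertex b -> T -> R) (u : vertex b)
    (w : T) : b.-tuple (measurableTypeR R) :=
  [tuple zeta (child u (child_of_colour (c ^~ w) u j)) w | j < b].

Definition xi_row (b : nat) (R : realType) (T : Type)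
    (xi : 'I_b -> 'I_b -> T -> R) (i : 'I_b) (x : T) :
    b.-tuple (measurableTypeR R) :=
  [tuple xi i j x | j < b].

(* Conditionally on the colouring, the sibling families are independent, and
   the one below u, ordered by colour, is distributed as the row c(u) of xi:
   the product under the integral is the conditional probability, given the
   colouring, that the family below u lies in B u for all u in U. *)
Definition edge_variables_law (d d' : measure_display)
    (Omega : measurableType d) (Omega' : measurableType d') (R : realType)
    (P : probability Omega R) (P' : probability Omega' R) (b : nat)
    (xi : 'I_b -> 'I_b -> Omega' -> R)
    (c : vertex b -> Omega -> 'I_b) (zeta : vertex b -> Omega -> R) : Prop :=
  forall (U : seq (vertex b)) (B : vertex b -> set (b.-tuple (measurableTypeR R)))
    (A : set Omega),
    uniq U -> (forall u, measurable (B u)) -> colour_algebra c A ->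
    (P (A `&` [set w | forall u, u \in U -> B u (edges_by_colour c zeta u w)]) =
     \int[P]_(w in A) \prod_(u <- U) P' (xi_row xi (c u w) @^-1` B u))%E.

Definition path_product (b : nat) (R : realType) (T : Type)
    (zeta : vertex b -> T -> R) (v : vertex b) (w : T) : R :=
  \prod_(i < size v) zeta (take i.+1 v) w.

Definition total_sum (b : nat) (R : realType) (T : Type)
    (zeta : vertex b -> T -> R) (w : T) : \bar R :=
  \esum_(v in [set: vertex b]) (path_product zeta v w)%:E.

Definition moment (d : measure_display) (T : measurableType d) (R : realType)
    (P : probability T R) (b : nat) (xi : 'I_b -> 'I_b -> T -> R) (s : R)
    (i j : 'I_b) : \bar R :=
  'E_P[fun x => (xi i j x `^ s)%R]%E.

Definition moment_mx (d : measure_display) (T : measurableType d)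
    (R : realType) (P : probability T R) (b : nat)
    (xi : 'I_b -> 'I_b -> T -> R) (s : R) : 'M[R]_b :=
  \matrix_(i, j) fine (moment P xi s i j).

Definition moment_domain (d : measure_display) (T : measurableType d)
    (R : realType) (P : probability T R) (b : nat)
    (xi : 'I_b -> 'I_b -> T -> R) : set R :=
  [set s | forall i j, (moment P xi s i j < +oo)%E].

(* The supremum is a maximum: a matrix with positive entries has finitely many
   real eigenvalues, and its Perron-Frobenius eigenvalue is among them. *)
Definition largest_eigenvalue (R : realType) (b : nat) (M : 'M[R]_b) : R :=
  sup [set a | eigenvalue M a].

Definition rho (d : measure_display) (T : measurableType d) (R : realType)
    (P : probability T R) (b : nat) (xi : 'I_b -> 'I_b -> T -> R) (s : R) :
    \bar R :=
  if `[< moment_domain P xi s >]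
  then (largest_eigenvalue (moment_mx P xi s))%:E else +oo%E.

Definition lambda1 (d : measure_display) (T : measurableType d) (R : realType)
    (P : probability T R) (b : nat) (xi : 'I_b -> 'I_b -> T -> R) : \bar R :=
  ereal_inf [set rho P xi s | s in `[0, 1]].

(* Main.v *)
Require Import Defs.
From HB Require Import structures.
From mathcomp Require Import all_boot all_order all_algebra.
From mathcomp Require Import all_classical all_reals all_analysis.
From mathcomp Require Import measurable_realfun ring lra.

(** Write [Z] for the sum of a function [phi] of the colour and the path product
    over the vertices of one level. Everything rests on one exact identity
    ([generation_integral]): conditionally on the first [n] levels, the
    expectation of [exp (- Z)] for level [n + 1] is the product over the vertices
    [u] of level [n] of [branch phi], an integral over one row of the matrix
    [xi]. Indeed the families of siblings are conditionally independent, and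
    almost surely the children of a vertex carry each colour exactly once, so that
    a sum over the children is a sum over the colours. Functions for which [branch]
    is bounded above or below by [exp (- psi)] therefore give monotone functionals
    along the levels ([generation_le], [generation_ge]).

    (a) If [rho s < 1], the moment matrix of exponent [s] has a positive vector
    [x] with [M x <= th x] and [th < 1] ([subinvariant_vector]), and [s > 0]
    because the matrix of exponent 0 has all entries 1. For
    [phi j z = x j * z ^ s], Jensen's inequality makes the expectation of
    [1 - exp (- Z)] decay like [th ^ n]; hence the level sums of the [s]-th powers
    are summable almost surely, and as [s <= 1] so are the path products.

    (b) If [rho] is bounded below by a constant above 1 on the unit interval, there
    is a bounded function [h] with [h j z <= C z], bounded away from 0 for [z >= 1], such that
    [branch h <= exp (- h)] ([exists_subsolution]). It is a small multiple of
    [u (s z) j * exp (S (ln z))], where [S] is concave with a slope [s] that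
    decreases from 1 to 0 so slowly that around each [z] the function looks like
    [u s j * z ^ s], with [u s] a vector expanded by the moment matrix of exponent
    [s]; the moments are truncated first, uniformly in [s], so that a generation
    moves [ln z] by a bounded amount. Where the total sum is finite the level sums
    tend to 0, so the functional of [h] tends to 1; being nonincreasing in mean,
    it bounds the probability of this event by its mean on any earlier level [m],
    at any scale. As the scale grows, each of the [b ^ m] vertices of that level
    contributes a factor at most [exp (- de)], and [m] is arbitrary. *)

Set Implicit Arguments.
Unset Strict Implicit.
Unset Printing Implicit Defensive.

Import Order.TTheory GRing.Theory Num.Theory.
Import numFieldNormedType.Exports.

Local Open Scope classical_set_scope.
Local Open Scope ring_scope.

(** * Measure theory *)

Section FiniteSelection.
Context {d} {T : measurableType d}.

Lemma measurable_finite_family (I J : finType) (g : I -> T -> J)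
    (Q : {ffun I -> J} -> Prop) :
  (forall i j, measurable (g i @^-1` [set j])) ->
  measurable [set w | Q [ffun i => g i w]].
Proof.
move=> mg; rewrite (_ : [set w | _] =
    \bigcup_(f in Q) \bigcap_(i in [set: I]) (g i @^-1` [set f i])).
  by apply: fin_bigcup_measurable => // f _; exact: fin_bigcap_measurable.
apply/seteqP; split=> w /=.
  by move=> Qw; exists [ffun i => g i w] => // i _; rewrite /= ffunE.
move=> [f Qf fw]; rewrite (_ : finfun _ = f) //.
by apply/ffunP => i; rewrite ffunE; exact: fw.
Qed.

Lemma measurable_fun_select {d'} {T' : measurableType d'} (I : finType)
    (K : T -> I) (f : I -> T -> T') :
  (forall k, measurable (K @^-1` [set k])) ->
  (forall k, measurable_fun setT (f k)) ->
  measurable_fun setT (fun w => f (K w) w).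
Proof.
move=> mK mf _ Y mY; rewrite setTI.
rewrite (_ : _ @^-1` _ = \bigcup_(k in [set: I]) (K @^-1` [set k] `&` f k @^-1` Y)).
  apply: fin_bigcup_measurable => // k _; apply: measurableI => //.
  by rewrite -[X in measurable X]setTI; exact: mf.
apply/seteqP; split=> w /=; first by move=> h; exists (K w).
by move=> [k _ [<-]].
Qed.

End FiniteSelection.

Lemma integral_probability_cst {R : realType} {d} {T : measurableType d}
  (P : probability T R) (r : \bar R) : (\int[P]_x r = r)%E.
Proof.
rewrite (integral_cst P measurableT) [X in (_ * X)%E](_ : _ = 1%E) ?mule1 //.
exact: probability_setT.
Qed.

Section Freezing.
Context {R : realType} {d d2 d'} {T : measurableType d}
  {T2 : measurableType d2} {T' : measurableType d'}.
Variables (P : probability T R) (P' : probability T' R).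

Lemma integral_mrestr (D : set T) (mD : measurable D) (f : T -> \bar R) :
  measurable_fun setT f -> (forall x, 0 <= f x)%E ->
  (\int[mrestr P mD]_x f x = \int[P]_(x in D) f x)%E.
Proof.
move=> mf f0.
transitivity (\int[mrestr P mD]_(x in D) f x)%E.
  have mDc : measurable (~` D) by exact: measurableC.
  rewrite -(setUv D) ge0_integral_setU //=; last 2 first.
  - by rewrite setUv.
  - by apply/disj_setPS; rewrite setICr.
  rewrite [X in (_ + X)%E](_ : _ = 0%E) ?adde0 //.
  apply: null_set_integral => //; first exact: measurable_funTS.
  by rewrite /= /mrestr setICl measure0.
apply: eq_measure_integral => A mA AD.
by rewrite /= /mrestr setIidl.
Qed.

(** On [D] the joint law of the [G]-measurable data and of [e] is a product
    measure, so [e] may be integrated out first, with the data frozen. *)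
Lemma freezing (G : set (set T)) (D : set T) (mD : measurable D)
    (e : T -> T2) (xi : T' -> T2) (f : g_sigma_algebraType G * T2 -> \bar R) :
  <<s G >> `<=` measurable ->
  measurable_fun setT e -> measurable_fun setT xi ->
  (forall A B, <<s G >> A -> measurable B ->
     P (A `&` D `&` e @^-1` B) = P (A `&` D) * P' (xi @^-1` B))%E ->
  measurable_fun setT f -> (forall z, 0 <= f z)%E ->
  (\int[P]_(w in D) f (w, e w) = \int[P]_(w in D) \int[P']_x f (w, xi x))%E.
Proof.
move=> GT me mxi ind mf f0.
pose idG : T -> g_sigma_algebraType G := id.
have midG : measurable_fun setT idG.
  by move=> _ Y mY; rewrite setTI; exact: GT.
pose eG w : g_sigma_algebraType G * T2 := (idG w, e w).
have meG : measurable_fun setT eG by exact: measurable_fun_pair.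
pose m1 : {measure set (g_sigma_algebraType G) -> \bar R} :=
  measure_function_pushforward__canonical__measure_function_Measure (mrestr P mD) midG.
have m1fin : fin_num_fun m1.
  move=> A mA; apply: fin_num_measure.
  by rewrite -[X in measurable X]setTI; exact: (midG measurableT A mA).
pose m1f : {finite_measure set (g_sigma_algebraType G) -> \bar R} :=
  HB.pack_for (FiniteMeasure.type _ R) (Measure.sort m1)
    (Measure_isFinite.Build _ _ _ m1 m1fin).
pose m2 : {measure set T2 -> \bar R} :=
  measure_function_pushforward__canonical__measure_function_Measure P' mxi.
have m2fin : fin_num_fun m2.
  move=> A mA; apply: fin_num_measure.
  by rewrite -[X in measurable X]setTI; exact: (mxi measurableT A mA).
pose m2f : {finite_measure set T2 -> \bar R} :=
  HB.pack_for (FiniteMeasure.type _ R) (Measure.sort m2)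
    (Measure_isFinite.Build _ _ _ m2 m2fin).
pose m12 : {measure set (g_sigma_algebraType G * T2) -> \bar R} :=
  measure_function_pushforward__canonical__measure_function_Measure (mrestr P mD) meG.
transitivity (\int[m12]_z f z)%E.
  rewrite ge0_integral_pushforward // preimage_setT integral_mrestr //=.
  exact: measurableT_comp.
transitivity (\int[(m1f \x m2f)%E]_z f z)%E.
  apply: eq_measure_integral => X mX _; apply/esym.
  apply: product_measure_unique => // A B mA mB.
  rewrite /= /pushforward /mrestr -ind //; congr (P _).
  by apply/seteqP; split=> w /= [[? ?] ?].
rewrite fubini_tonelli1 //.
have mF : measurable_fun setT (fubini_F m2f f) by exact: measurable_fun_fubini_tonelli_F.
have FE w : fubini_F m2f f w = (\int[P']_x f (w, xi x))%E.
  rewrite /fubini_F ge0_integral_pushforward //.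
  exact: measurableT_comp.
rewrite ge0_integral_pushforward //; last first.
  by move=> w _; exact: integral_ge0.
rewrite preimage_setT integral_mrestr //; last 2 first.
- exact: measurableT_comp mF midG.
- by move=> w; exact: integral_ge0.
by apply: eq_integral => w _; rewrite /= FE.
Qed.

End Freezing.

Lemma nneseries_cvg0 {R : realType} (a : nat -> R) : (forall n, 0 <= a n) ->
  (\sum_(n <oo) (a n)%:E < +oo)%E -> a @ \oo --> 0.
Proof.
move=> a0 fin; apply: cvg_series_cvg_0; apply: nondecreasing_is_cvgn.
  by apply/nondecreasing_seqP => n; rewrite seriesEord /= big_ord_recr /= lerDl.
exists (fine (\sum_(n <oo) (a n)%:E)) => _ [N _ <-]; rewrite seriesEord /=.
rewrite -lee_fin fineK; last first.
  by rewrite ge0_fin_numE // nneseries_ge0 // => n _ _; rewrite lee_fin.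
rewrite -sumEFin -(big_mkord xpredT (fun n => (a n)%:E)).
by apply: nneseries_lim_ge => n _ _; rewrite lee_fin.
Qed.

(** * Nonnegative matrices *)

Section PositiveMatrices.
Context {R : realType} {b : nat}.
Implicit Types (M : 'I_b -> 'I_b -> R) (x y w : 'I_b -> R) (A : 'M[R]_b) (t : R).

Definition mulv M x (i : 'I_b) : R := \sum_j M i j * x j.

Lemma exists_argmax (i0 : 'I_b) x : exists i, forall j, x j <= x i.
Proof.
have [i _ hi] := @Order.TotalTheory.arg_maxP _ _ 'I_b i0 xpredT x isT.
by exists i => j; apply: hi.
Qed.

Lemma nonunit_kernel A : A \notin unitmx ->
  exists2 v : 'rV[R]_b, v *m A = 0 & v != 0.
Proof.
rewrite -row_free_unit -kermx_eq0 => /rowV0Pn[v /sub_kermxP vA v0].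
by exists v.
Qed.

Lemma not_eigenvalue_unit A t : ~ eigenvalue A t -> (t%:M - A) \in unitmx.
Proof.
apply: contra_notT => /nonunit_kernel[v].
rewrite mulmxBr mul_mx_scalar => /eqP; rewrite subr_eq0 => /eqP vA v0.
by apply/eigenvalueP; exists v.
Qed.

Lemma eigenvalue_bounded A t : eigenvalue A t -> t <= \sum_i \sum_j `|A i j|.
Proof.
move=> /eigenvalueP[v vA v0].
have [j0 vj0] : exists j, v 0 j != 0.
  apply/existsP; apply: contraNT v0; rewrite negb_exists => /forallP h.
  by apply/eqP/rowP => j; rewrite mxE; apply/eqP; have := h j; rewrite negbK.
have [j hj] := exists_argmax j0 (fun j => `|v 0 j|).
have vj : 0 < `|v 0 j| by apply: lt_le_trans (hj j0); rewrite normr_gt0.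
apply: le_trans (ler_norm t) _; rewrite -(ler_pM2r vj) -normrM.
have := congr1 (fun z : 'rV_b => z 0 j) vA; rewrite !mxE => <-.
apply: le_trans (ler_norm_sum _ _ _) _.
rewrite mulr_suml; apply: ler_sum => i _.
rewrite normrM mulrC; apply: ler_pM => //.
by rewrite (bigD1 j) //= lerDl sumr_ge0.
Qed.

(** With a positive strict supersolution [x], the matrix [t - A] is a
    nonsingular M-matrix. A kernel vector, and likewise the negative part of a
    solution in [supersolution_inverse_ge0], is compared at the index where it
    touches a multiple of [x]. *)
Lemma supersolution_unit A t x :
  (forall i j, 0 <= A i j) -> (forall i, 0 < x i) ->
  (forall i, mulv A x i < t * x i) -> (t%:M - A) \in unitmx.
Proof.
move=> A0 x0 Ax; apply/negPn/negP; rewrite -unitmx_tr => /nonunit_kernel[v].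
rewrite linearB /= tr_scalar_mx mulmxBr mul_mx_scalar => /eqP.
rewrite subr_eq0 => /eqP vA /eqP; apply.
have tv i : t * v 0 i = \sum_j A i j * v 0 j.
  have := congr1 (fun z : 'rV_b => z 0 i) vA; rewrite !mxE => ->.
  by apply: eq_bigr => j _; rewrite mxE mulrC.
apply/rowP => j0; rewrite mxE.
have [i hi] := exists_argmax j0 (fun i => `|v 0 i| / x i).
set c := `|v 0 i| / x i in hi.
have hv j : `|v 0 j| <= c * x j by rewrite -ler_pdivrMr.
have t0 : 0 < t.
  rewrite -(pmulr_lgt0 _ (x0 i)); apply: le_lt_trans (Ax i).
  by apply: sumr_ge0 => j _; rewrite mulr_ge0 // ltW.
have [c0|c0] := leP c 0.
  have := le_trans (hv j0) (mulr_le0_ge0 c0 (ltW (x0 j0))).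
  by rewrite normr_le0 => /eqP.
have : t * `|v 0 i| <= c * mulv A x i.
  rewrite -[X in X * _ <= _](gtr0_norm t0) -normrM tv.
  apply: le_trans (ler_norm_sum _ _ _) _.
  rewrite mulr_sumr; apply: ler_sum => j _.
  by rewrite normrM ger0_norm // mulrCA ler_wpM2l.
have -> : `|v 0 i| = c * x i by rewrite /c mulfVK // gt_eqF.
rewrite mulrCA ler_pM2l // leNgt.
by rewrite Ax.
Qed.

Lemma supersolution_inverse_ge0 A t x y :
  (forall i j, 0 <= A i j) -> (forall i, 0 < x i) ->
  (forall i, mulv A x i < t * x i) ->
  (forall i, t * y i = 1 + mulv A y i) -> forall i, 0 <= y i.
Proof.
move=> A0 x0 Ax Ay i0.
have [i hi] := exists_argmax i0 (fun i => - y i / x i).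
set c := - y i / x i in hi.
have hy j : - y j <= c * x j by rewrite -ler_pdivrMr.
have [c0|c0] := leP c 0.
  by rewrite -oppr_le0 (le_trans (hy i0)) // mulr_le0_ge0 // ltW.
have yi : y i = - (c * x i) by rewrite /c mulfVK ?opprK // gt_eqF.
have : - (c * mulv A x i) <= mulv A y i.
  rewrite mulr_sumr -sumrN; apply: ler_sum => j _.
  by rewrite mulrCA -mulrN ler_wpM2l // lerNl.
have := Ay i; rewrite yi => e.
have := Ax i; rewrite -(ltr_pM2l c0) => h1 h2.
exfalso; lra.
Qed.

(** The infimum of the [t] that admit a positive vector with [A x <= t x] is a
    real eigenvalue, the Perron root: if [r - A] were invertible, the solutions
    of [t y - A y = 1] would stay bounded as [t] decreases to [r], and would
    then be supersolutions for some [t] below [r]. *)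
Lemma subinvariant_vector A t : (0 < b)%N -> (forall i j, 0 <= A i j) ->
  (forall a, eigenvalue A a -> a < t) ->
  exists2 x : 'I_b -> R, forall i, 0 < x i &
    exists2 th, 0 <= th < t & forall i, mulv A x i <= th * x i.
Proof.
move=> b0 A0 ev; pose i0 := Ordinal b0.
pose D := [set th : R | 0 <= th /\ exists2 x : 'I_b -> R,
   forall i, 0 < x i & forall i, mulv A x i <= th * x i].
have D0 : D !=set0.
  exists (\sum_i \sum_j A i j); split.
    by apply: sumr_ge0 => i _; apply: sumr_ge0.
  exists (fun=> 1) => // i; rewrite mulr1 /mulv.
  under eq_bigr do rewrite mulr1.
  rewrite [leRHS](bigD1 i) //= lerDl; apply: sumr_ge0 => k _; exact: sumr_ge0.
have Dlb : has_lbound D by exists 0 => th [].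
have Dinf : has_inf D by split.
pose r := inf D.
have r0 : 0 <= r by apply: lb_le_inf => // th [].
have rev : eigenvalue A r.
  have [//|/negP /not_eigenvalue_unit rU] := boolP (eigenvalue A r).
  pose B := invmx (r%:M - A).
  pose be := 1 + \sum_i \sum_j `|B i j|.
  have be1 : 1 <= be.
    by rewrite lerDl; apply: sumr_ge0 => i _; apply: sumr_ge0.
  have be0 : 0 < be by apply: lt_le_trans be1.
  pose e := (4 * be)^-1.
  have e0 : 0 < e by rewrite invr_gt0 mulr_gt0.
  have ebe : e * be = 4^-1 by rewrite /e invfM mulfVK // gt_eqF.
  have [th [th0 [x x0 Ax]] thr] := inf_adherent e0 Dinf.
  set s := r + e.
  have s0 : 0 < s by rewrite ltr_wpDl.
  have Axs i : mulv A x i < s * x i.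
    by apply: le_lt_trans (Ax i) _; rewrite ltr_pM2r.
  have sU := supersolution_unit A0 x0 Axs.
  have [yv yvE] : exists yv : 'cV[R]_b, (s%:M - A) *m yv = const_mx 1.
    by exists (invmx (s%:M - A) *m const_mx 1); rewrite mulKVmx.
  pose y i := yv i 0.
  have yE i : s * y i = 1 + mulv A y i.
    move: yvE; rewrite mulmxBl mul_scalar_mx.
    move=> /(congr1 (fun z : 'cV_b => z i 0)); rewrite !mxE.
    by move=> /eqP; rewrite subr_eq => /eqP.
  have y0 := supersolution_inverse_ge0 A0 x0 Axs yE.
  have yB i : y i = \sum_j B i j * (1 - e * y j).
    have h : (r%:M - A) *m yv = \col_j (1 - e * y j).
      apply/colP => j; rewrite mulmxBl mul_scalar_mx !mxE.
      have := yE j; rewrite /s mulrDl /mulv -/(y j) => ye.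
      by rewrite -/(y j); rewrite /y in ye *; lra.
    have := mulKmx rU yv; rewrite h => /(congr1 (fun z : 'cV_b => z i 0)).
    rewrite -/B mxE -/(y i) => <-; apply: eq_bigr => j _; by rewrite mxE.
  have [i hi] := exists_argmax i0 y.
  have ybe : y i <= be * (1 + e * y i).
    rewrite {1}yB /be mulrDl mul1r.
    have z0 : 0 <= 1 + e * y i by rewrite addr_ge0 // mulr_ge0 // ltW.
    apply: (@le_trans _ _ ((\sum_i \sum_j `|B i j|) * (1 + e * y i))); last first.
      by rewrite lerDr.
    rewrite mulr_suml [leRHS](bigD1 i) //= mulr_suml ler_wpDr //.
      by apply: sumr_ge0 => k _; rewrite mulr_ge0 // sumr_ge0.
    apply: ler_sum => j _; apply: le_trans (ler_norm _) _.
    rewrite normrM ler_wpM2l // (le_trans (ler_normB _ _)) // normr1 lerD2l.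
    by rewrite normrM (gtr0_norm e0) ger0_norm // ler_pM2l.
  have y2 j : y j <= 2 * be.
    apply: le_trans (hi j) _; move: ybe.
    by rewrite mulrDr mulr1 mulrA [be * e]mulrC ebe; lra.
  have yp j : 0 < y j.
    rewrite -(pmulr_rgt0 _ s0) yE ltr_pwDl //.
    by apply: sumr_ge0 => k _; rewrite mulr_ge0.
  have : D (r - e).
    have Ay j : mulv A y j <= (r - e) * y j.
      have := yE j; rewrite /s => h.
      have h2 : 2 * e * y j <= 1.
        apply: (@le_trans _ _ (2 * e * (2 * be))).
          by rewrite ler_pM2l // mulr_gt0.
        by rewrite mulrACA ebe; lra.
      by rewrite mulrDl in h; rewrite mulrBl; lra.
    split; last by exists y.
    rewrite -(pmulr_lge0 _ (yp i)); apply: le_trans (Ay i).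
    by apply: sumr_ge0 => k _; rewrite mulr_ge0.
  by move=> /(ge_inf Dlb); rewrite -/r; lra.
have rt : 0 < t - r by rewrite subr_gt0 ev.
have [th [th0 [x x0 Ax]] thr] := inf_adherent rt Dinf.
by exists x => //; exists th => //; rewrite th0 /=; move: thr; rewrite -/r; lra.
Qed.

Lemma mulv_iter_ge0 M n i : (forall i j, 0 <= M i j) ->
  0 <= iter n (mulv M) (fun=> 1) i.
Proof.
move=> M0; elim: n i => //= n IH i.
by apply: sumr_ge0 => j _; rewrite mulr_ge0.
Qed.

(** The absolute value of an eigenvector is a subsolution of the transposed
    problem; pairing it with the iterates shows that some coordinate grows at
    the rate [c * a]. *)
Lemma iter_growth M A a c n : (forall i j, 0 <= A i j) ->
  0 <= a -> 0 <= c -> eigenvalue A a -> (forall i j, c * A i j <= M i j) ->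
  exists i, (c * a) ^+ n <= iter n (mulv M) (fun=> 1) i.
Proof.
move=> A0 a0 c0 /eigenvalueP[v vA v0] MA.
have M0 i j : 0 <= M i j by apply: le_trans (MA i j); rewrite mulr_ge0.
pose w i := `|v 0 i|.
have w0 i : 0 <= w i by rewrite /w.
have wA j : c * a * w j <= \sum_i w i * M i j.
  have e : a * w j = `|\sum_i v 0 i * A i j|.
    have := congr1 (fun z : 'rV_b => z 0 j) vA; rewrite !mxE => ->.
    by rewrite normrM (ger0_norm a0).
  rewrite -mulrA e; apply: (@le_trans _ _ (c * \sum_i `|v 0 i * A i j|)).
    by rewrite ler_wpM2l // ler_norm_sum.
  rewrite mulr_sumr; apply: ler_sum => i _.
  by rewrite normrM [`|A i j|]ger0_norm // mulrCA ler_wpM2l.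
have grow m : (c * a) ^+ m * \sum_i w i <=
    \sum_i w i * iter m (mulv M) (fun=> 1) i.
  elim: m => [|m IH].
    by rewrite expr0 mul1r; apply: ler_sum => i _; rewrite mulr1.
  rewrite exprS -mulrA.
  apply: (@le_trans _ _ (c * a * \sum_i w i * iter m (mulv M) (fun=> 1) i)).
    by rewrite ler_wpM2l // mulr_ge0.
  rewrite mulr_sumr /=.
  under [leRHS]eq_bigr do rewrite /mulv mulr_sumr.
  rewrite exchange_big /=; apply: ler_sum => j _; rewrite mulrA.
  apply: (@le_trans _ _ ((\sum_i w i * M i j) * iter m (mulv M) (fun=> 1) j)).
    by apply: ler_wpM2r => //; apply: mulv_iter_ge0.
  by rewrite mulr_suml; apply: ler_sum => i _; rewrite mulrA.
have [j0 vj0] : exists j, v 0 j != 0.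
  apply/existsP; apply: contraNT v0; rewrite negb_exists => /forallP h.
  by apply/eqP/rowP => j; rewrite mxE; apply/eqP; have := h j; rewrite negbK.
have [i hi] := exists_argmax j0 (iter n (mulv M) (fun=> 1)).
have sw : 0 < \sum_i w i.
  rewrite (bigD1 j0) //= ltr_pwDl ?normr_gt0 //.
  by apply: sumr_ge0.
exists i; rewrite -(ler_pM2r sw); apply: le_trans (grow n) _.
by rewrite mulr_sumr; apply: ler_sum => j _; rewrite mulrC ler_wpM2r.
Qed.

(** A truncated Neumann series: a vector that [M] expands by the factor [ka] as
    soon as [M ^ N] expands the constant vector by [ka ^ N]. Unlike a Perron
    eigenvector it is an explicit polynomial in the entries of [M]. *)
Definition geometric_sum_vector M (ka : R) N (i : 'I_b) : R :=
  \sum_(k < N) ka ^- k * iter k (mulv M) (fun=> 1) i.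

Lemma geometric_sum_subsolution M ka N i : 0 < ka ->
  ka ^+ N <= iter N (mulv M) (fun=> 1) i ->
  ka * geometric_sum_vector M ka N i <= mulv M (geometric_sum_vector M ka N) i.
Proof.
move=> ka0 hN.
have -> : mulv M (geometric_sum_vector M ka N) i =
    \sum_(k < N) ka ^- k * iter k.+1 (mulv M) (fun=> 1) i.
  rewrite /mulv /geometric_sum_vector; under eq_bigr do rewrite mulr_sumr.
  rewrite exchange_big /=; apply: eq_bigr => k _; rewrite /mulv mulr_sumr.
  by apply: eq_bigr => j _; rewrite mulrCA.
have kaN k : ka * ka ^- k.+1 = ka ^- k.
  by rewrite exprS invfM mulVKf // gt_eqF.
rewrite /geometric_sum_vector mulr_sumr.
case: N hN => [|N] hN; first by rewrite !big_ord0.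
rewrite big_ord_recl big_ord_recr /= addrC expr0 invr1 !mul1r mulr1.
apply: lerD.
  by rewrite ler_pdivlMl ?exprn_gt0 // -exprSr.
by apply: ler_sum => k _; rewrite mulrA kaN.
Qed.

End PositiveMatrices.

Section Comparison.
Context {R : realType} {b : nat}.
Implicit Types M : 'I_b -> 'I_b -> R.

Lemma iter_mulv_compare M (M' : 'I_b -> 'I_b -> R) q k i :
  0 <= q -> (forall i j, 0 <= M i j) ->
  (forall i j, q * M i j <= M' i j) ->
  q ^+ k * iter k (mulv M) (fun=> 1) i <= iter k (mulv M') (fun=> 1) i.
Proof.
move=> q0 M0 MM'; elim: k i => [|k IH] i; first by rewrite mul1r.
rewrite exprS /= /mulv mulr_sumr; apply: ler_sum => j _.
rewrite mulrACA; apply: ler_pM => //; first exact: mulr_ge0.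
by rewrite mulr_ge0 ?exprn_ge0 // mulv_iter_ge0.
Qed.

Lemma geometric_sum_vector_compare M (M' : 'I_b -> 'I_b -> R) ka q N i :
  0 < ka -> 0 <= q <= 1 ->
  (forall i j, 0 <= M i j) -> (forall i j, q * M i j <= M' i j) ->
  q ^+ N * geometric_sum_vector M ka N i <= geometric_sum_vector M' ka N i.
Proof.
move=> ka0 /andP[q0 q1] M0 MM'; rewrite mulr_sumr; apply: ler_sum => k _.
rewrite mulrCA ler_wpM2l //; first by rewrite invr_ge0 exprn_ge0 // ltW.
apply: le_trans (iter_mulv_compare k i q0 M0 MM').
by rewrite ler_wpM2r ?mulv_iter_ge0 // ler_wiXn2l // ltnW.
Qed.

Lemma geometric_sum_vector_ge1 M ka N i : 0 < ka -> (forall i j, 0 <= M i j) ->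
  1 <= geometric_sum_vector M ka N.+1 i.
Proof.
move=> ka0 M0; rewrite /geometric_sum_vector big_ord_recl expr0 invr1 mul1r.
rewrite lerDl; apply: sumr_ge0 => k _.
by rewrite mulr_ge0 ?mulv_iter_ge0 // invr_ge0 exprn_ge0 // ltW.
Qed.

Lemma measurable_geometric_sum_vector {d} {T : measurableType d}
    (M : T -> 'I_b -> 'I_b -> R) ka N i :
  (forall i j, measurable_fun setT (fun t => M t i j)) ->
  measurable_fun setT (fun t => geometric_sum_vector (M t) ka N i).
Proof.
move=> mM; apply: measurable_sum => k; apply: measurable_funM => //.
elim: (nat_of_ord k) i => [|n IH] i; first exact: measurable_cst.
by apply: measurable_sum => j; apply: measurable_funM; [exact: mM|exact: IH].
Qed.

Lemma exists_expr_ge (k x : R) : 1 < k -> exists n, x <= k ^+ n.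
Proof.
move=> k1; have bern n : n%:R * (k - 1) <= k ^+ n.
  elim: n => [|n IH]; first by rewrite mul0r.
  have : 1 <= k ^+ n by rewrite exprn_ege1 // ltW.
  rewrite exprS -natr1 mulrDl mul1r => h.
  have : 0 <= (k - 1) * (k ^+ n - 1) by rewrite mulr_ge0 // subr_ge0 // ltW.
  by lra.
exists (Num.truncn (x / (k - 1))).+1; apply: le_trans (bern _).
by rewrite -ler_pdivrMr ?subr_gt0 // ltW // truncnS_gt.
Qed.

End Comparison.

(** * A slowly varying profile *)

Section Profile.
Context {R : realType}.
Variable L : R.
Hypothesis L0 : 0 < L.

(** [ln (profile z)] is the minimum over [0 <= s <= 1] of
    [s * ln z + L * s ^ 2 / 2], attained at [slope z]: a concave function of
    [ln z] whose slope decreases from 1 to 0 with Lipschitz constant [1 / L]. *)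
Definition slope (z : R) : R := Num.max 0 (Num.min 1 (- ln z / L)).

Definition profile (z : R) : R :=
  expR (slope z * ln z + L * slope z ^+ 2 / 2).

Lemma slope_ge0 z : 0 <= slope z. Proof. by rewrite /slope le_max lexx. Qed.

Lemma slope_le1 z : slope z <= 1.
Proof. by rewrite /slope ge_max ler01 ge_min lexx. Qed.

Lemma slope_lipschitz z y A : 0 < z -> 0 < y -> `|ln y| <= A ->
  `|slope (z * y) - slope z| <= A / L.
Proof.
move=> z0 y0 yA; rewrite /slope lnM ?posrE // opprD mulrDl.
set q := - ln z / L; set r := - ln y / L.
have : `|r| <= A / L.
  by rewrite normrM normrN (gtr0_norm (x := L^-1)) ?invr_gt0 // ler_pM2r ?invr_gt0.
rewrite !ler_norml; move: (A / L) => B /andP[h1 h2].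
rewrite /Num.max /Num.min.
case: (ltP 1 (q + r)) => ?; case: (ltP 1 q) => ?;
  do !case: ltP => ?; apply/andP; split; lra.
Qed.

Lemma slope_minimizes z s : 0 <= s <= 1 ->
  slope z * ln z + L * slope z ^+ 2 / 2 + L * (s - slope z) ^+ 2 / 2 <=
  s * ln z + L * s ^+ 2 / 2.
Proof.
move=> /andP[s0 s1].
pose q := - ln z / L.
have -> : ln z = - (L * q) by rewrite /q mulrCA mulfV ?gt_eqF // mulr1 opprK.
suff : 0 <= (s - slope z) * (slope z - q).
  move=> h; have := mulr_ge0 (ltW L0) h; rewrite !expr2 => h'; lra.
rewrite /slope -/q /Num.max /Num.min.
case: (ltP 1 q) => hq; case: ltP => hq'; nra.
Qed.

Lemma profile_gt0 z : 0 < profile z. Proof. exact: expR_gt0. Qed.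

Lemma profile_le1 z : profile z <= 1.
Proof.
rewrite -expR0 ler_expR.
have := @slope_minimizes z 0; rewrite lexx ler01 => /(_ isT).
rewrite mul0r expr0n /= mulr0 mul0r addr0 sub0r sqrrN.
have : 0 <= L * slope z ^+ 2 / 2 by rewrite divr_ge0 // mulr_ge0 ?sqr_ge0 // ltW.
by lra.
Qed.

Lemma profile_le z : 0 < z -> profile z <= expR (L / 2) * z.
Proof.
move=> z0; rewrite -[X in _ <= _ * X](lnK z0) -expRD ler_expR.
have := @slope_minimizes z 1; rewrite lexx ler01 => /(_ isT).
have : 0 <= L * (1 - slope z) ^+ 2 / 2.
  by rewrite divr_ge0 // mulr_ge0 ?sqr_ge0 // ltW.
by rewrite expr1n mulr1 mul1r; lra.
Qed.

Lemma profile_eq1 z : 1 <= z -> profile z = 1.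
Proof.
move=> z1; rewrite /profile (_ : slope z = 0); last first.
  rewrite /slope; apply/max_idPl; rewrite ge_min; apply/orP; right.
  by rewrite mulNr oppr_le0 divr_ge0 ?ln_ge0 // ltW.
by rewrite mul0r expr0n /= mulr0 mul0r addr0 expR0.
Qed.

Lemma profile_mul z y A : 0 < z -> 0 < y -> `|ln y| <= A ->
  expR (- (A ^+ 2 / (2 * L))) * (profile z * expR (slope z * ln y)) <=
  profile (z * y).
Proof.
move=> z0 y0 yA; rewrite -!expRD ler_expR.
have := @slope_minimizes z (slope (z * y)).
rewrite slope_ge0 slope_le1 => /(_ isT).
rewrite lnM ?posrE //.
set s := slope z; set s' := slope (z * y); set l := ln y in yA *.
have l2 : l ^+ 2 <= A ^+ 2.
  by rewrite -(real_normK (num_real l)) lerXn2r // nnegrE (le_trans _ yA).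
have : - (A ^+ 2 / (2 * L)) <= (s' - s) * l + L * (s' - s) ^+ 2 / 2.
  rewrite -subr_ge0 opprK.
  have : 0 <= (L * (s' - s) + l) ^+ 2 / (2 * L).
    by rewrite divr_ge0 ?sqr_ge0 // mulr_ge0 // ltW.
  have -> : (L * (s' - s) + l) ^+ 2 / (2 * L) =
      (s' - s) * l + L * (s' - s) ^+ 2 / 2 + l ^+ 2 / (2 * L).
    by field; rewrite gt_eqF.
  have : l ^+ 2 / (2 * L) <= A ^+ 2 / (2 * L).
    by rewrite ler_pM2r // invr_gt0 mulr_gt0.
  by lra.
by lra.
Qed.

Lemma measurable_slope : measurable_fun setT slope.
Proof.
apply: measurable_maxr; first exact: measurable_cst.
apply: measurable_minr; first exact: measurable_cst.
by apply: measurable_funM => //; apply: measurableT_comp => //.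
Qed.

Lemma measurable_profile : measurable_fun setT profile.
Proof.
apply: measurableT_comp => //; apply: measurable_funD.
  apply: measurable_funM; [exact: measurable_slope|exact: measurable_ln].
apply: measurable_funM => //; apply: measurable_funM => //.
exact: measurable_funX measurable_slope.
Qed.

End Profile.

(** * Truncated moments *)

Section TruncatedMoments.
Context {R : realType} {b : nat} {d' : measure_display} {Omega' : measurableType d'}
  {P' : probability Omega' R}.
Variable xi : 'I_b -> 'I_b -> {RV P' >-> R}.
Hypothesis xi_gt0 : forall i j, {ae P', forall x, 0 < xi i j x}.

Definition log_bounded (A : R) i j : set Omega' :=
  [set x | 0 < xi i j x /\ `|ln (xi i j x)| <= A].

Lemma measurable_log_bounded A i j : measurable (log_bounded A i j).
Proof.
have mX : measurable_fun setT (xi i j) by exact: measurable_funP.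
have -> : log_bounded A i j = (xi i j @^-1` `]0, +oo[) `&`
    ((fun x => `|ln (xi i j x)|) @^-1` `]-oo, A]).
  by apply/seteqP; split=> x /=; rewrite !in_itv /= andbT.
apply: measurableI; rewrite -[X in measurable X]setTI.
  exact: (mX measurableT).
have : measurable_fun setT (fun x => `|ln (xi i j x)|).
  by apply: measurableT_comp => //; exact: measurableT_comp.
by apply.
Qed.

Definition truncated_power (A s : R) i j x : R :=
  \1_(log_bounded A i j) x * expR (s * ln (xi i j x)).

Lemma truncated_power_ge0 A s i j x : 0 <= truncated_power A s i j x.
Proof. by rewrite mulr_ge0 ?expR_ge0 // indicE ler0n. Qed.

Lemma truncated_power_le A s i j x : truncated_power A s i j x <= expR (`|s| * A).
Proof.
rewrite /truncated_power indicE; case: (boolP (x \in _)) => [/[!inE] -[_ xA]|_] /=; last first.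
  by rewrite mul0r expR_ge0.
rewrite mul1r ler_expR (le_trans (ler_norm _)) // normrM.
by rewrite ler_wpM2l.
Qed.

Lemma measurable_truncated_power A i j :
  measurable_fun setT (fun sx => truncated_power A sx.1 i j sx.2).
Proof.
apply: measurable_funM.
  have mI : measurable_fun setT (\1_(log_bounded A i j) : Omega' -> R).
    by apply: measurable_indic; exact: measurable_log_bounded.
  exact: (measurableT_comp mI measurable_snd).
apply: measurableT_comp => //; apply: measurable_funM => //.
apply: measurableT_comp => //.
exact: (measurableT_comp (measurable_funP (xi i j)) measurable_snd).
Qed.

Lemma measurable_truncated_power1 A s i j :
  measurable_fun setT (truncated_power A s i j).
Proof. exact: measurableT_comp (measurable_truncated_power A i j) (pair1_measurable s). Qed.

Definition truncated_moment (A s : R) i j : R :=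
  fine (\int[P']_x (truncated_power A s i j x)%:E).

Lemma truncated_moment_ge0 A s i j : 0 <= truncated_moment A s i j.
Proof.
by apply/fine_ge0/integral_ge0 => x _; rewrite lee_fin truncated_power_ge0.
Qed.

Lemma integral_truncated_power A s i j :
  (\int[P']_x (truncated_power A s i j x)%:E = (truncated_moment A s i j)%:E)%E.
Proof.
rewrite fineK // ge0_fin_numE; last first.
  by apply: integral_ge0 => x _; rewrite lee_fin truncated_power_ge0.
apply: (@le_lt_trans _ _ (\int[P']_x (expR (`|s| * A))%:E)%E).
  apply: ge0_le_integral => //.
  - by move=> x _; rewrite lee_fin truncated_power_ge0.
  - exact/measurable_EFinP/measurable_truncated_power1.
  - by move=> x _; rewrite lee_fin truncated_power_le.
by rewrite integral_probability_cst ltry.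
Qed.

Lemma measurable_truncated_moment A i j :
  measurable_fun setT (fun s => truncated_moment A s i j).
Proof.
apply: measurableT_comp => //.
apply: (@measurable_fun_fubini_tonelli_F _ _ R Omega' R P'
  (fun sx => (truncated_power A sx.1 i j sx.2)%:E)).
  by apply/measurable_EFinP; have := measurable_truncated_power A i j.
by move=> sx; rewrite lee_fin truncated_power_ge0.
Qed.

Lemma truncated_moment_le A s i j : truncated_moment A s i j <= expR (`|s| * A).
Proof.
rewrite -lee_fin -integral_truncated_power.
rewrite -[leRHS](integral_probability_cst P').
apply: ge0_le_integral => //.
- by move=> x _; rewrite lee_fin truncated_power_ge0.
- exact/measurable_EFinP/measurable_truncated_power1.
- by move=> x _; rewrite lee_fin truncated_power_le.
Qed.

(** On the truncated range the integrands for the exponents [s] and [t] differ at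
    most by the factor [exp (A * |s - t|)]. *)
Lemma truncated_moment_lipschitz A s t i j :
  expR (- (A * `|s - t|)) * truncated_moment A t i j <= truncated_moment A s i j.
Proof.
rewrite -lee_fin EFinM -!integral_truncated_power -ge0_integralZl //.
- apply: ge0_le_integral => //.
  + by move=> x _; rewrite mule_ge0 // lee_fin ?expR_ge0 ?truncated_power_ge0.
  + by apply: measurable_funeM; exact/measurable_EFinP/measurable_truncated_power1.
  + exact/measurable_EFinP/measurable_truncated_power1.
  move=> x _; rewrite -EFinM lee_fin /truncated_power indicE.
  case: (boolP (x \in _)) => [/[!inE] -[_ xA]|_] /=; last by rewrite !mul0r mulr0.
  rewrite !mul1r -expRD ler_expR.
  have h : `|(s - t) * ln (xi i j x)| <= `|s - t| * A by rewrite normrM ler_wpM2l.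
  by move: h; rewrite ler_norml mulrBl => /andP[]; lra.
- exact/measurable_EFinP/measurable_truncated_power1.
- by move=> x _; rewrite lee_fin truncated_power_ge0.
Qed.


Section Approximation.
Hypothesis hD : `[0, 1] `<=` moment_domain P' xi.

Definition power_moment s i j : R := fine (moment P' xi s i j).

Lemma integral_powR s i j : 0 <= s <= 1 ->
  (\int[P']_x (xi i j x `^ s)%:E = (power_moment s i j)%:E)%E.
Proof.
move=> s01; have := @hD s; rewrite /= in_itv /= s01 => /(_ isT) /(_ i j).
rewrite /power_moment /moment unlock => h; rewrite fineK // ge0_fin_numE //.
by apply: integral_ge0 => x _; rewrite lee_fin powR_ge0.
Qed.

Lemma measurable_powR_xi s i j : measurable_fun setT (fun x => xi i j x `^ s).
Proof. exact: (measurableT_comp (measurable_powR s) (measurable_funP (xi i j))). Qed.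

Let tail A i j x : R := \1_(~` log_bounded A i j) x * (1 + xi i j x `^ 1).

Let tail_ge0 A i j x : 0 <= tail A i j x.
Proof. by rewrite mulr_ge0 ?indicE ?ler0n // addr_ge0 ?powR_ge0. Qed.

Let measurable_tail A i j : measurable_fun setT (tail A i j).
Proof.
apply: measurable_funM.
  by apply: measurable_indic; apply: measurableC; exact: measurable_log_bounded.
by apply: measurable_funD => //; exact: measurable_powR_xi.
Qed.

Let tail_cvg0 i j :
  (fun n : nat => \int[P']_x (tail n%:R i j x)%:E)%E @ \oo --> 0%E.
Proof.
have ig : P'.-integrable setT (fun x => (1 + xi i j x `^ 1)%:E).
  apply/integrableP; split.
    apply/measurable_EFinP; apply: measurable_funD => //.
    exact: measurable_powR_xi.
  under eq_integral => x _.
    rewrite gee0_abs; last by rewrite lee_fin addr_ge0 ?powR_ge0.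
    rewrite EFinD; over.
  rewrite ge0_integralD //; last 2 first.
  - by move=> x _; rewrite lee_fin powR_ge0.
  - exact/measurable_EFinP/measurable_powR_xi.
  rewrite integral_probability_cst integral_powR ?ler01 ?lexx //.
  by rewrite -EFinD ltry.
have [] // := @dominated_convergence _ _ _ P' setT measurableT
  (fun n x => (tail n%:R i j x)%:E) (cst 0%E) (fun x => (1 + xi i j x `^ 1)%:E).
- by move=> n; exact/measurable_EFinP.
- apply: filterS (xi_gt0 i j) => x x0 _; apply: cvg_near_cst.
  have [N NE] : exists N : nat, `|ln (xi i j x)| <= N%:R.
    by exists (Num.truncn `|ln (xi i j x)|).+1; rewrite ltW // truncnS_gt.
  exists N => // n /= Nn; rewrite /tail indicE memNset ?mul0r //=.
  by apply; split=> //; rewrite (le_trans NE) // ler_nat.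
- apply: aeW => x n _; rewrite gee0_abs ?lee_fin // /tail indicE.
  by case: (_ \in _); rewrite ?mul1r // mul0r addr_ge0 ?powR_ge0.
by move=> _ _; rewrite integral_cst // mul0e.
Qed.

Lemma powR_le1D (a s : R) : 0 < a -> 0 <= s <= 1 -> a `^ s <= 1 + a `^ 1.
Proof.
move=> a0 /andP[s0 s1]; have [a1|a1] := leP 1 a.
  by rewrite (le_trans (ler_powR a1 s1)) // lerDr.
rewrite -[leLHS]addr0 lerD ?powR_ge0 //.
by rewrite /powR gt_eqF // -expR0 ler_expR mulr_ge0_le0 // ln_le0 // ltW.
Qed.

Lemma power_moment_le A s i j : 0 <= s <= 1 ->
  ((power_moment s i j)%:E <=
   (truncated_moment A s i j)%:E + \int[P']_x (tail A i j x)%:E)%E.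
Proof.
move=> s01; rewrite -integral_powR // -integral_truncated_power.
rewrite -ge0_integralD //; last 4 first.
- by move=> x _; rewrite lee_fin truncated_power_ge0.
- exact/measurable_EFinP/measurable_truncated_power1.
- by move=> x _; rewrite lee_fin.
- exact/measurable_EFinP.
apply: ae_ge0_le_integral => //.
- by move=> x _; rewrite lee_fin powR_ge0.
- exact/measurable_EFinP/measurable_powR_xi.
- by move=> x _; rewrite adde_ge0 ?lee_fin ?truncated_power_ge0.
- by apply: emeasurable_funD; apply/measurable_EFinP => //; exact: measurable_truncated_power1.
apply: filterS (xi_gt0 i j) => x x0 _; rewrite -EFinD lee_fin.
rewrite /truncated_power /tail !indicE in_setC.
case: (boolP (x \in _)) => _ /=; rewrite !(mul0r, mul1r, addr0, add0r).
  by rewrite /powR gt_eqF.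
exact: powR_le1D.
Qed.

Lemma truncated_moment_le_power A s i j : 0 <= s <= 1 ->
  truncated_moment A s i j <= power_moment s i j.
Proof.
move=> s01; rewrite -lee_fin -integral_powR // -integral_truncated_power.
apply: ae_ge0_le_integral => //.
- by move=> x _; rewrite lee_fin truncated_power_ge0.
- exact/measurable_EFinP/measurable_truncated_power1.
- by move=> x _; rewrite lee_fin powR_ge0.
- exact/measurable_EFinP/measurable_powR_xi.
apply: filterS (xi_gt0 i j) => x x0 _; rewrite lee_fin.
rewrite /truncated_power indicE /powR gt_eqF //.
by case: (x \in _); rewrite ?mul1r // mul0r expR_ge0.
Qed.

Let tail_small e i j : 0 < e ->
  exists N : nat, forall n, (N <= n)%N -> (\int[P']_x (tail n%:R i j x)%:E <= e%:E)%E.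
Proof.
move=> e0; have /fine_cvgP[] := @tail_cvg0 i j.
move=> [N1 _ fin1] /cvgrPdist_le /(_ e e0) [N2 _ h2].
exists (maxn N1 N2) => n; rewrite geq_max => /andP[n1 n2].
have := h2 n n2; rewrite /= sub0r normrN -lee_fin.
move/(le_trans _); apply; rewrite -[leLHS]fineK ?lee_fin ?ler_norm //.
exact: fin1.
Qed.

(** For exponents between 0 and 1 the discarded part is dominated by the tail of
    [1 + xi], whatever the exponent; a lower bound for the moments comes from the
    exponent 0, by the Lipschitz dependence of the truncated moments. *)
Lemma truncation_approx i j e : 0 < e -> exists N : nat, exists2 al, 0 < al &
  forall n s, (N <= n)%N -> 0 <= s <= 1 ->
    (1 - e) * power_moment s i j <= truncated_moment n%:R s i j /\
    (1 - e) * al <= truncated_moment n%:R s i j.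
Proof.
move=> e0.
have half0 : 0 < 2^-1 :> R by [].
have [N1 hN1] := tail_small i j half0.
pose al : R := expR (- N1%:R) / 2.
have al0 : 0 < al by rewrite divr_gt0 ?expR_gt0.
have alM s : 0 <= s <= 1 -> al <= power_moment s i j.
  move=> s01; apply: le_trans (truncated_moment_le_power N1%:R i j s01).
  have := @power_moment_le N1%:R 0 i j; rewrite lexx ler01 => /(_ isT) h.
  have M0 : power_moment 0 i j = 1.
    rewrite /power_moment /moment unlock.
    under eq_integral do rewrite powRr0.
    by rewrite integral_probability_cst.
  have T0 : 2^-1 <= truncated_moment N1%:R 0 i j.
    have := le_trans h (leeD2l _ (hN1 N1 (leqnn _))).
    by rewrite -EFinD lee_fin M0; lra.
  have := truncated_moment_lipschitz N1%:R s 0 i j.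
  apply: le_trans; rewrite /al; apply: ler_pM; rewrite ?expR_ge0 //.
  rewrite ler_expR lerN2 subr0 ger0_norm; last by case/andP: s01.
  by rewrite ler_piMr //; case/andP: s01.
have [N2 hN2] := tail_small i j (mulr_gt0 e0 al0).
exists N2, al => // n s Nn s01.
have h : (1 - e) * power_moment s i j <= truncated_moment n%:R s i j.
  have := le_trans (power_moment_le n%:R i j s01) (leeD2l _ (hN2 n Nn)).
  rewrite -EFinD lee_fin => h.
  have : e * al <= e * power_moment s i j by rewrite ler_pM2l // alM.
  by lra.
split=> //.
have [e1|e1] := leP 0 (1 - e).
  by apply: le_trans h; rewrite ler_wpM2l // alM.
by rewrite (le_trans _ (truncated_moment_ge0 _ _ _ _)) // mulr_le0_ge0 // ltW.
Qed.

End Approximation.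

End TruncatedMoments.

(** * A bounded subsolution of the branching equation *)

Section Subsolution.
Context {R : realType} {b : nat} {d' : measure_display} {Omega' : measurableType d'}
  {P' : probability Omega' R}.
Variable xi : 'I_b -> 'I_b -> {RV P' >-> R}.
Hypothesis xi_gt0 : forall i j, {ae P', forall x, 0 < xi i j x}.
Hypothesis hD : `[0, 1] `<=` moment_domain P' xi.
Variable i0 : 'I_b.

Lemma lambda1_gt_eigenvalue : (1 < lambda1 P' xi)%E -> exists2 a0 : R, 1 < a0 &
  forall s, 0 <= s <= 1 -> exists2 a, a0 < a & eigenvalue (moment_mx P' xi s) a.
Proof.
move=> l1; have [a0 a1 al] : exists2 a0 : R, 1 < a0 & (a0%:E < lambda1 P' xi)%E.
  case: (lambda1 P' xi) l1 => [r| |] //; last first.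
    by move=> _; exists 2; rewrite ?ltry // ltr1n.
  by rewrite !lte_fin => r1; exists ((1 + r) / 2); rewrite ?lte_fin; lra.
exists a0 => // s s01.
have hs : moment_domain P' xi s by apply: hD; rewrite /= in_itv.
have : (a0%:E < rho P' xi s)%E.
  apply: lt_le_trans al _; apply: ereal_inf_lbound.
  by exists s => //=; rewrite in_itv.
rewrite /rho asboolT // lte_fin /largest_eigenvalue => h.
have [|y /= ye ay] := sup_gt _ h; last by exists y.
apply/set0P/eqP => e; move: h; rewrite e sup0.
by apply/negP; rewrite -leNgt (le_trans ler01) // ltW.
Qed.

(** An eigenvector of the moment matrix makes some coordinate of the iterates
    grow at a rate above 1, and one more step spreads this growth to all
    coordinates. The bounds on the entries are uniform in the exponent, hence so
    are the truncation level and the number of steps. *)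
Lemma uniform_expansion : (1 < lambda1 P' xi)%E -> exists (A ka : R) N,
  [/\ 0 <= A, 1 < ka & forall s i, 0 <= s <= 1 ->
    ka ^+ N.+1 <= iter N.+1 (mulv (truncated_moment xi A s)) (fun=> 1) i].
Proof.
move=> /lambda1_gt_eigenvalue[a0 a1 ev].
(* [ka ^ 3 <= a0]: truncation costs one factor [ka], and [ka ^ (2 * m)] beats
   [ka ^ m.+1] together with the constant [be] when [m] is large *)
pose t : R := Num.min 1 ((a0 - 1) / 7).
have t0 : 0 < t by rewrite lt_min ltr01 divr_gt0 // subr_gt0.
have t1 : t <= 1 by rewrite ge_min lexx.
have ta : t <= (a0 - 1) / 7 by rewrite ge_min lexx orbT.
pose ka := 1 + t; have ka1 : 1 < ka by rewrite ltrDl.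
have ka0 : 0 < ka by apply: lt_trans ka1.
have kaV : 0 < ka^-1 by rewrite invr_gt0.
have ka3 : ka ^+ 3 <= a0.
  have : ka ^+ 3 <= 1 + 7 * t by rewrite /ka; nra.
  by lra.
pose e := 1 - ka^-1.
have e0 : 0 < e by rewrite subr_gt0 invf_lt1.
have eE : 1 - e = ka^-1 by rewrite /e; lra.
have /choice[N hN] : forall ij : 'I_b * 'I_b, exists N : nat, exists2 al, 0 < al &
  forall n s, (N <= n)%N -> 0 <= s <= 1 ->
    (1 - e) * power_moment xi s ij.1 ij.2 <= truncated_moment xi n%:R s ij.1 ij.2 /\
    (1 - e) * al <= truncated_moment xi n%:R s ij.1 ij.2.
  by move=> ij; exact: truncation_approx.
have /choice[al hal] : forall ij : 'I_b * 'I_b, exists al, 0 < al /\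
  forall n s, (N ij <= n)%N -> 0 <= s <= 1 ->
    (1 - e) * power_moment xi s ij.1 ij.2 <= truncated_moment xi n%:R s ij.1 ij.2 /\
    (1 - e) * al <= truncated_moment xi n%:R s ij.1 ij.2.
  by move=> ij; have [al ? ?] := hN ij; exists al.
pose n0 := (\max_ij N ij)%N.
have Nn0 ij : (N ij <= n0)%N by exact: leq_bigmax.
have [ij0 _ hij] := @Order.TotalTheory.arg_minP _ _ ('I_b * 'I_b)%type (i0, i0) xpredT al isT.
pose be := ka^-1 * al ij0.
have be0 : 0 < be by rewrite mulr_gt0 // (hal ij0).1.
have Tbe s i j : 0 <= s <= 1 -> be <= truncated_moment xi n0%:R s i j.
  move=> s01; have [_ h] := hal (i, j); have [_] := h n0 s (Nn0 _) s01.
  by apply: le_trans; rewrite eE ler_pM2l // hij.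
have [m hm] := exists_expr_ge (ka / be) ka1.
exists n0%:R, ka, m; split=> // s i s01.
have [a aa0 eva] := ev s s01.
have [k hk] : exists k, (ka^-1 * a) ^+ m <=
    iter m (mulv (truncated_moment xi n0%:R s)) (fun=> 1) k.
  apply: (iter_growth (A := moment_mx P' xi s)) => //.
  - by move=> i' j'; rewrite mxE; apply/fine_ge0; rewrite /moment unlock;
      apply: integral_ge0 => x _; rewrite lee_fin powR_ge0.
  - by apply: ltW; apply: lt_trans aa0; apply: lt_trans a1.
  - exact: ltW.
  move=> i' j'; rewrite mxE -eE; have [_ h] := hal (i', j').
  by have [] := h n0 s (Nn0 _) s01.
have T0 := truncated_moment_ge0 xi n0%:R s.
rewrite /= {1}/mulv (bigD1 k) //=.
have rest : 0 <= \sum_(j < b | j != k) truncated_moment xi n0%:R s i j *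
    iter m (mulv (truncated_moment xi n0%:R s)) (fun=> 1) j.
  by apply: sumr_ge0 => j _; rewrite mulr_ge0 // mulv_iter_ge0.
apply: ler_wpDr => //.
apply: (@le_trans _ _ (be * (ka ^+ 2) ^+ m)).
  rewrite -exprM mulnC muln2 -addnn exprD exprS.
  rewrite mulrA ler_pM2r ?exprn_gt0 // -ler_pdivrMl //.
  by rewrite mulrC.
apply: ler_pM => //; first exact: ltW.
- by rewrite exprn_ge0 // exprn_ge0 // ltW.
- exact: Tbe.
apply: le_trans hk; rewrite lerXn2r ?nnegrE //.
- by rewrite exprn_ge0 // ltW.
- by rewrite mulr_ge0 ?ltW //; apply: lt_trans aa0; apply: lt_trans a1.
by rewrite ler_pdivlMl // -exprS (le_trans ka3) // ltW.
Qed.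


Lemma expRN_le (y q : R) : 0 <= y -> y <= q -> q < 1 ->
  expR (- y) + (1 - q) * y <= 1.
Proof.
move=> y0 yq q1.
have h : expR (- y) <= (1 + y)^-1.
  rewrite expRN lef_pV2 ?posrE ?expR_gt0 ?expR_ge1Dx //.
  by rewrite ltr_pwDl.
have h2 : (1 + y)^-1 <= 1 - (1 - q) * y.
  rewrite -[leLHS]mul1r ler_pdivrMr; last by rewrite ltr_pwDl.
  by nra.
by lra.
Qed.

(** With [u s] a vector expanded by the moment matrix of exponent [s], the
    function [u (slope z) i * profile z] locally looks like the expanded
    function [u s i * z ^ s] at every [z], because the slope varies slowly; a
    small multiple of it absorbs the quadratic error of the exponential. *)
Lemma exists_subsolution : (1 < lambda1 P' xi)%E ->
  exists h : 'I_b -> R -> R, [/\ forall j, measurable_fun setT (h j),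
    exists C, forall j z, 0 < z -> 0 <= h j z <= C * z,
    exists2 de, 0 < de & forall j z, 1 <= z -> de <= h j z &
    forall i z, 0 < z ->
      (\int[P']_x (expR (- \sum_j h j (z * xi i j x)))%:E <=
       (expR (- h i z))%:E)%E].
Proof.
move=> /uniform_expansion[A [ka [N [A0 ka1 expand]]]].
have ka0 : 0 < ka by apply: lt_trans ka1.
pose T := truncated_moment xi A.
have T0 s i j : 0 <= T s i j by exact: truncated_moment_ge0.
pose u s := geometric_sum_vector (T s) ka N.+1.
(* [L] is so large that the losses due to the varying slope leave the factor
   [ka'], between 1 and [ka] *)
pose K := N.+1%:R * A ^+ 2 + A ^+ 2 / 2 + 1.
have K0 : 0 < K.
  by rewrite ltr_wpDl // addr_ge0 ?mulr_ge0 ?divr_ge0 ?sqr_ge0.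
pose ka' := (1 + ka) / 2.
have [ka'1 ka'k] : 1 < ka' /\ ka' < ka by rewrite /ka'; split; lra.
have ka'0 : 0 < ka' by apply: lt_trans ka'1.
pose L := K * ka / (ka - ka').
have L0 : 0 < L by rewrite divr_gt0 ?mulr_gt0 // subr_gt0.
have KL : 1 - K / L = ka' / ka.
  by rewrite /L; field; rewrite ?gt_eqF // ?subr_gt0 //.
pose f i z := u (slope L z) i * profile L z.
pose Cu : R := \sum_(i < b) geometric_sum_vector (fun _ _ : 'I_b => expR A) ka N.+1 i.
have cst0 (i j : 'I_b) : 0 <= expR A by exact: expR_ge0.
have s01 z : 0 <= slope L z <= 1 by rewrite slope_ge0 slope_le1.
have u1 s i : 1 <= u s i by exact: geometric_sum_vector_ge1.
have u0 s i : 0 < u s i by exact: lt_le_trans (u1 s i).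
have uC s i : 0 <= s <= 1 -> u s i <= Cu.
  move=> /andP[s0 s1].
  apply: (@le_trans _ _ (geometric_sum_vector (fun _ _ => expR A) ka N.+1 i)).
    have := @geometric_sum_vector_compare _ _ (T s) (fun _ _ => expR A) ka 1 N.+1 i ka0.
    rewrite expr1n mul1r lexx ler01; apply=> // j k; rewrite mul1r.
    apply: le_trans (truncated_moment_le _ _ _ _ _) _.
    by rewrite ler_expR ger0_norm // ler_piMl.
  rewrite /Cu (bigD1 i) //= lerDl; apply: sumr_ge0 => k _.
  by rewrite (le_trans ler01) // geometric_sum_vector_ge1.
have Cu1 : 1 <= Cu by apply: le_trans (uC 0 i0 _); rewrite ?lexx ?ler01.
have Cu0 : 0 < Cu by apply: lt_le_trans Cu1.
have f0 i z : 0 < f i z by rewrite mulr_gt0 // profile_gt0.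
have fC i z : f i z <= Cu.
  rewrite -[leRHS]mulr1; apply: ler_pM => //.
  - exact: ltW.
  - exact/ltW/profile_gt0.
  - exact: uC.
  - exact: profile_le1.
have fz i z : 0 < z -> f i z <= Cu * expR (L / 2) * z.
  move=> z0; rewrite -mulrA; apply: ler_pM => //.
  - exact: ltW.
  - exact/ltW/profile_gt0.
  - exact: uC.
  - exact: profile_le.
have f1 i z : 1 <= z -> 1 <= f i z.
  by move=> z1; rewrite /f profile_eq1 // mulr1.
have mu i : measurable_fun setT (fun s => u s i).
  apply: measurable_geometric_sum_vector => j k.
  exact: measurable_truncated_moment.
have mf i : measurable_fun setT (f i).
  apply: measurable_funM; last exact: measurable_profile.
  exact: (measurableT_comp (mu i) (measurable_slope L)).
have mfxi i j z : measurable_fun setT (fun x => f j (z * xi i j x)).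
  apply: (measurableT_comp (mf j)); apply: measurable_funM => //.
(* on the truncated range the slope changes by at most [A / L], which costs
   the factor [r], so one generation still multiplies [f] by [ka'] *)
pose q0 := expR (- (A * (A / L))).
pose r := q0 ^+ N.+1 * expR (- (A ^+ 2 / (2 * L))).
have r0 : 0 < r by rewrite mulr_gt0 ?exprn_gt0 ?expR_gt0.
have rka : ka' <= r * ka.
  rewrite -ler_pdivrMr // -KL.
  have -> : r = expR (- ((N.+1%:R * A ^+ 2 + A ^+ 2 / 2) / L)).
    rewrite /r /q0 -expRM_natl -expRD; congr expR.
    by field; rewrite gt_eqF.
  apply: le_trans (expR_ge1Dx _); rewrite lerD2l lerN2 ler_pM2r ?invr_gt0 //.
  by rewrite /K lerDl.
have q01 : 0 <= q0 <= 1.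
  rewrite expR_ge0 -expR0 ler_expR oppr_le0.
  by rewrite mulr_ge0 // divr_ge0 // ltW.
have point i j z x : 0 < z ->
    r * (u (slope L z) j * profile L z) * truncated_power xi A (slope L z) i j x
    <= f j (z * xi i j x).
  move=> z0; rewrite /truncated_power indicE.
  case: (boolP (x \in _)) => [/[!inE] -[x0 xA]|_] /=; last first.
    by rewrite mul0r mulr0 ltW.
  rewrite mul1r /f.
  have -> : r * (u (slope L z) j * profile L z) * expR (slope L z * ln (xi i j x)) =
     (q0 ^+ N.+1 * u (slope L z) j) *
     (expR (- (A ^+ 2 / (2 * L))) * (profile L z * expR (slope L z * ln (xi i j x)))).
    by rewrite /r; ring.
  apply: ler_pM.
  - by rewrite mulr_ge0 ?exprn_ge0 ?expR_ge0 // ltW.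
  - by rewrite !mulr_ge0 ?expR_ge0.
  - apply: geometric_sum_vector_compare => // k l.
    apply: le_trans (truncated_moment_lipschitz _ A _ (slope L z) k l).
    rewrite ler_wpM2r // ler_expR lerN2 ler_wpM2l //.
    exact: slope_lipschitz.
  - exact: profile_mul.
have gain i z : 0 < z ->
    ((ka' * f i z)%:E <= \int[P']_x (\sum_j f j (z * xi i j x))%:E)%E.
  move=> z0; set s := slope L z.
  apply: (@le_trans _ _ (\sum_j (r * (u s j * profile L z) * T s i j)%:E)%E).
    rewrite sumEFin lee_fin.
    have -> : \sum_j r * (u s j * profile L z) * T s i j =
        r * profile L z * mulv (T s) (u s) i.
      by rewrite /mulv mulr_sumr; apply: eq_bigr => j _; ring.
    apply: (@le_trans _ _ (r * profile L z * (ka * u s i))).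
      have -> : r * profile L z * (ka * u s i) = (r * ka) * f i z.
        by rewrite /f; ring.
      by rewrite ler_pM2r.
    rewrite ler_pM2l; last by rewrite mulr_gt0 // profile_gt0.
    by apply: geometric_sum_subsolution => //; exact: (expand s i (s01 z)).
  rewrite (eq_integral (fun x => \sum_j (f j (z * xi i j x))%:E)%E); last first.
    by move=> x _; rewrite sumEFin.
  rewrite ge0_integral_sum //; last 2 first.
  - by move=> j; exact/measurable_EFinP.
  - by move=> j x _; rewrite lee_fin ltW.
  apply: lee_sum => j _; rewrite EFinM -integral_truncated_power.
  have c0 : 0 <= r * (u s j * profile L z) by exact: ltW (mulr_gt0 r0 (f0 j z)).
  rewrite -ge0_integralZl //.
  - apply: ge0_le_integral => //.
    + by move=> x _; rewrite mule_ge0 // lee_fin truncated_power_ge0.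
    + apply: measurable_funeM; apply/measurable_EFinP.
      exact: measurable_truncated_power1.
    + exact/measurable_EFinP.
    + by move=> x _; rewrite -EFinM lee_fin; exact: point.
  - exact/measurable_EFinP/measurable_truncated_power1.
  - by move=> x _; rewrite lee_fin truncated_power_ge0.
(* [de * f] sums to at most [q] over the siblings, and [(1 - q) * ka' = 1]
   pays for replacing the exponential by its linear part *)
have b0 : 0 < b%:R :> R by rewrite ltr0n (leq_ltn_trans _ (ltn_ord i0)).
pose q := (ka' - 1) / ka'.
have [q0' q1] : 0 < q /\ q < 1.
  split; first by rewrite divr_gt0 // subr_gt0.
  by rewrite ltr_pdivrMr // mul1r ltrBlDr ltrDl.
have qka : (1 - q) * ka' = 1 by rewrite /q; field; rewrite gt_eqF.
pose de := q / (b%:R * Cu).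
have de0 : 0 < de by rewrite divr_gt0 // mulr_gt0.
exists (fun i z => de * f i z); split.
- by move=> j; apply: measurable_funM.
- exists (de * (Cu * expR (L / 2))) => j z z0.
  by rewrite mulr_ge0 ?(ltW de0) ?(ltW (f0 _ _)) //= -[leRHS]mulrA ler_pM2l // fz.
- by exists de => // j z z1; rewrite ler_peMr ?f1 // ltW.
move=> i z z0.
pose Y x := \sum_j de * f j (z * xi i j x).
have Y0 x : 0 <= Y x.
  by apply: sumr_ge0 => j _; rewrite mulr_ge0 // ltW.
have Yq x : Y x <= q.
  apply: (@le_trans _ _ (\sum_(j < b) de * Cu)).
    by apply: ler_sum => j _; rewrite ler_pM2l.
  rewrite sumr_const card_ord -mulr_natl /de.
  have -> : b%:R * (q / (b%:R * Cu) * Cu) = q by field; rewrite !gt_eqF.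
  exact: lexx.
have mY : measurable_fun setT Y.
  by apply: measurable_sum => j; apply: measurable_funM.
have YE : (\int[P']_x (Y x)%:E =
    de%:E * \int[P']_x (\sum_j f j (z * xi i j x))%:E)%E.
  rewrite -ge0_integralZl ?lee_fin ?(ltW de0) //.
  - by apply: eq_integral => x _; rewrite /Y -mulr_sumr EFinM.
  - by apply/measurable_EFinP; exact: measurable_sum.
  - by move=> x _; rewrite lee_fin; apply: sumr_ge0 => j _; rewrite ltW.
have total : (\int[P']_x (expR (- Y x))%:E + (1 - q)%:E * \int[P']_x (Y x)%:E <= 1)%E.
  rewrite -ge0_integralZl ?lee_fin ?subr_ge0 ?(ltW q1) //; last 2 first.
  - exact/measurable_EFinP.
  - by move=> x _; rewrite lee_fin.
  rewrite -ge0_integralD //; last 3 first.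
  - by apply/measurable_EFinP; apply: measurableT_comp => //; exact: measurableT_comp.
  - by move=> x _; rewrite mule_ge0 // lee_fin // subr_ge0 ltW.
  - by apply: measurable_funeM; exact/measurable_EFinP.
  rewrite -[leRHS](integral_probability_cst P').
  apply: ge0_le_integral => //.
  - by move=> x _; rewrite adde_ge0 ?mule_ge0 // lee_fin ?expR_ge0 // subr_ge0 ltW.
  - apply: emeasurable_funD.
      by apply/measurable_EFinP; apply: measurableT_comp => //; exact: measurableT_comp.
    by apply: measurable_funeM; exact/measurable_EFinP.
  - by move=> x _; rewrite -EFinM -EFinD lee_fin expRN_le.
have lower : ((de * f i z)%:E <= (1 - q)%:E * \int[P']_x (Y x)%:E)%E.
  rewrite YE muleA -EFinM.
  have -> : de * f i z = (1 - q) * de * (ka' * f i z).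
    by rewrite [RHS]mulrACA qka mul1r.
  rewrite [leLHS]EFinM; apply: lee_wpmul2l; last exact: gain.
  by rewrite lee_fin mulr_ge0 ?(ltW de0) // subr_ge0 ltW.
have : (\int[P']_x (expR (- Y x))%:E + (de * f i z)%:E <= 1)%E.
  by apply: le_trans total; exact: leeD2l.
rewrite -leeBrDr // => /le_trans; apply.
by rewrite -EFinB lee_fin expR_ge1Dx.
Qed.

End Subsolution.

(** * The labelled tree *)

(** The default Borel structure of [R] and [measurableTypeR R] have the same
    measurable sets, but not the same display. *)
Lemma measurable_funTR (R : realType) d (T : measurableType d) (f : T -> R) :
  measurable_fun setT f -> measurable_fun setT (f : T -> measurableTypeR R).
Proof. by move=> mf mD Y mY; apply: mf. Qed.

Lemma measurable_tnthR (R : realType) (n : nat) (i : 'I_n) :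
  measurable_fun setT (fun t : n.-tuple (measurableTypeR R) => tnth t i : R).
Proof.
have h := @measurable_tnth _ (measurableTypeR R) n i.
by move=> mD Y mY; apply: h.
Qed.

Section LabelledTree.
Context {R : realType} {b : nat} {d' : measure_display} {Omega' : measurableType d'}
  {P' : probability Omega' R} {xi : 'I_b -> 'I_b -> {RV P' >-> R}}
  {d : measure_display} {Omega : measurableType d} {P : probability Omega R}
  {c0 : 'I_b} {c : vertex b -> Omega -> 'I_b}
  {zeta : vertex b -> {RV P >-> R}}.
Hypothesis hc : random_colouring P c0 c.
Hypothesis hzeta : edge_variables_law P P' xi c zeta.
Hypothesis xi_gt0 : forall i j, {ae P', forall x, 0 < xi i j x}.

Local Notation edges := (edges_by_colour c zeta).

Lemma measurable_child_of_colour u j k :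
  measurable [set w | child_of_colour (c ^~ w) u j = k].
Proof.
have := @measurable_finite_family _ _ _ _ (fun k w => c (child u k) w)
  (fun f => odflt j [pick k | f k == j] = k)
  (fun k' j' => colour_measurable hc (child u k') j').
congr measurable; apply/seteqP; split=> w /= <-; rewrite /child_of_colour;
  by congr odflt; apply: eq_pick => k' /=; rewrite ffunE.
Qed.

Lemma measurable_edges u : measurable_fun setT (edges u).
Proof.
apply/measurable_fun_tnthP => j.
have := @measurable_fun_select _ _ _ _ _ (fun w => child_of_colour (c ^~ w) u j)
  (fun k => zeta (child u k) : Omega -> measurableTypeR R).
move=> /(_ (measurable_child_of_colour u j)).
rewrite (_ : _ \o _ = fun w => zeta (child u (child_of_colour (c ^~ w) u j)) w).
  by apply=> k; exact/measurable_funTR/measurable_funP.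
by apply/funext => w /=; rewrite tnth_mktuple.
Qed.

Lemma measurable_xi_row i : measurable_fun setT (xi_row xi i).
Proof.
apply/measurable_fun_tnthP => j.
rewrite (_ : _ \o _ = xi i j); first exact/measurable_funTR/measurable_funP.
by apply/funext => w /=; rewrite tnth_mktuple.
Qed.

(** A pi-system that generates the sigma-algebra of the whole labelled tree
    except the variables on the edges just below [u]. *)
Definition away_from (u : vertex b) : set (set Omega) :=
  [set A | exists (U : seq (vertex b))
      (B : vertex b -> set (b.-tuple (measurableTypeR R))) A0,
    [/\ u \notin U, forall v, measurable (B v),
    colour_algebra c A0 &
    A = A0 `&` [set w | forall v, v \in U -> B v (edges v w)]]].

Lemma colour_algebra_measurable A : colour_algebra c A -> measurable A.
Proof.
apply: smallest_sub; first exact: sigma_algebra_measurable.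
by move=> _ [v [i ->]]; exact: (colour_measurable hc).
Qed.

Lemma measurable_edge_events (U : seq (vertex b))
    (B : vertex b -> set (b.-tuple (measurableTypeR R))) :
  (forall v, measurable (B v)) ->
  measurable [set w | forall v, v \in U -> B v (edges v w)].
Proof.
move=> mB; rewrite (_ : [set w | _] = \bigcap_(v in [set` U]) (edges v @^-1` B v)).
  apply: fin_bigcap_measurable => // v _.
  by rewrite -[X in measurable X]setTI; exact: measurable_edges.
by apply/seteqP; split.
Qed.

Lemma away_from_measurable u : <<s away_from u >> `<=` measurable.
Proof.
apply: smallest_sub; first exact: sigma_algebra_measurable.
move=> _ [U [B [A0 [_ mB /colour_algebra_measurable mA ->]]]].
by apply: measurableI => //; exact: measurable_edge_events.
Qed.

Lemma colour_algebraI A B : colour_algebra c A -> colour_algebra c B ->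
  colour_algebra c (A `&` B).
Proof.
move=> mA mB.
pose T1 := g_sigma_algebraType [set A | exists u i, A = c u @^-1` [set i]].
exact: (@measurableI _ T1).
Qed.

Lemma away_from_setI_closed u : setI_closed (away_from u).
Proof.
move=> _ _ [U1 [B1 [A1 [u1 mB1 mA1 ->]]]] [U2 [B2 [A2 [u2 mB2 mA2 ->]]]].
exists (U1 ++ U2), (fun v => (if v \in U1 then B1 v else setT) `&`
  (if v \in U2 then B2 v else setT)), (A1 `&` A2); split.
- by rewrite mem_cat negb_or u1.
- by move=> v; apply: measurableI; case: ifP.
- exact: colour_algebraI.
apply/seteqP; split=> w /=.
  by move=> [[? h1] [? h2]]; split=> // v _; split; case: ifPn => // ?;
    [exact: h1|exact: h2].
move=> [[? ?] h]; split; split=> // v vU.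
  by have := (h v); rewrite mem_cat vU => /(_ isT) [].
by have := (h v); rewrite mem_cat vU orbT => /(_ isT) [_].
Qed.

Lemma colour_algebra_colour v i : colour_algebra c (c v @^-1` [set i]).
Proof. by apply: sub_sigma_algebra; exists v, i. Qed.

(** Both sides are finite measures in [A], and on the generating pi-system they
    agree by the law of the edge variables, used with and without [u]. *)
Lemma edges_independent u i A B : <<s away_from u >> A -> measurable B ->
  (P (A `&` (c u @^-1` [set i]) `&` edges u @^-1` B) =
   P (A `&` (c u @^-1` [set i])) * P' (xi_row xi i @^-1` B))%E.
Proof.
move=> uA mB; set D := c u @^-1` [set i].
have mD : measurable D by exact: (colour_measurable hc).
have mE : measurable (edges u @^-1` B).
  by rewrite -[X in measurable X]setTI; exact: measurable_edges.
have mDE : measurable (D `&` edges u @^-1` B) by exact: measurableI.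
have mX : measurable (xi_row xi i @^-1` B).
  by rewrite -[X in measurable X]setTI; exact: measurable_xi_row.
have pfin : P' (xi_row xi i @^-1` B) \is a fin_num by exact: fin_num_measure.
pose q : {nonneg R} := NngNum (fine_ge0 (measure_ge0 P' (xi_row xi i @^-1` B))).
pose m1 : {measure set Omega -> \bar R} := mrestr P mDE.
pose m2 : {measure set Omega -> \bar R} := mscale q (mrestr P mD).
have m1E X : m1 X = P (X `&` D `&` edges u @^-1` B) by rewrite /m1 /= /mrestr setIA.
have m2E X : m2 X = (P (X `&` D) * P' (xi_row xi i @^-1` B))%E.
  by rewrite /m2 /= /mscale /= /mrestr fineK // muleC.
suff agree X : away_from u X -> m1 X = m2 X.
  rewrite -m1E -m2E.
  have HE : [set X | away_from u X /\ X `<=` setT] = away_from u.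
    by apply/seteqP; split=> X //=; case.
  apply: (g_sigma_algebra_measure_unique_trace (away_from u) setT) => //;
    rewrite ?HE //.
  - by move=> X uX; apply: (@away_from_measurable u); exact: sub_sigma_algebra.
  - exact: away_from_setI_closed.
  - apply: agree; exists [::], (fun=> setT), setT; split=> //.
      exact: (@measurableT _ (g_sigma_algebraType
        [set A | exists u i, A = c u @^-1` [set i]])).
    by rewrite setTI; apply/seteqP; split.
  - by rewrite m1E ltey_eq fin_num_measure //; apply: measurableI => //; apply: measurableI.
move=> [V [C [A0 [uV mC mA0 ->]]]].
rewrite m1E m2E.
pose C' v := if v == u then B else C v.
have mC' v : measurable (C' v) by rewrite /C'; case: ifP.
have A0D : colour_algebra c (A0 `&` D).
  by apply: colour_algebraI => //; exact: colour_algebra_colour.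
have e1 : A0 `&` D `&` [set w | forall v, v \in u :: undup V -> C' v (edges v w)] =
    A0 `&` [set w | forall v, v \in V -> C v (edges v w)] `&` D `&` edges u @^-1` B.
  apply/seteqP; split=> w /=.
    move=> [[? ?] h]; split; last first.
      by have := h u (mem_head _ _); rewrite /C' eqxx.
    split=> //; split=> // v vV.
    have vu : v == u = false by apply: contraNF uV => /eqP <-.
    by have := h v; rewrite inE mem_undup vV orbT /C' vu => /(_ isT).
  move=> [[[? h] ?] hB]; split=> // v; rewrite inE mem_undup /C'.
  by case: eqVneq => [->|_] //= /h.
have e2 : A0 `&` D `&` [set w | forall v, v \in undup V -> C v (edges v w)] =
    A0 `&` [set w | forall v, v \in V -> C v (edges v w)] `&` D.
  apply/seteqP; split=> w /=.
    move=> [[? ?] h]; split=> //; split=> // v vV.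
    by apply: h; rewrite mem_undup.
  by move=> [[? h] ?]; split=> // v; rewrite mem_undup => /h.
have uuV : uniq (u :: undup V) by rewrite /= mem_undup uV undup_uniq.
have := hzeta uuV mC' A0D; rewrite e1 => ->.
have := hzeta (undup_uniq V) mC A0D; rewrite e2 => ->.
set F := fun w => (\prod_(v <- undup V) P' (xi_row xi (c v w) @^-1` C v))%E.
have mA0D : measurable (A0 `&` D) by exact: colour_algebra_measurable.
have mF : measurable_fun setT F.
  rewrite /F; elim: (undup V) => [|v s IH].
    by under eq_fun do rewrite big_nil; exact: measurable_cst.
  under eq_fun do rewrite big_cons; apply: emeasurable_funM IH.
  apply: (measurable_fun_select (K := c v)
    (f := fun k (_ : Omega) => P' (xi_row xi k @^-1` C v))) => // k.
  exact: (colour_measurable hc).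
have F0 w : (0 <= F w)%E.
  by rewrite /F; elim/big_ind: _ => // x y; exact: mule_ge0.
rewrite muleC -ge0_integralZl //; last 2 first.
- exact: measurable_funTS mF.
- by move=> w _; exact: F0.
apply: eq_integral => w; rewrite inE => -[_ wD].
rewrite /F big_cons /C' eqxx wD; congr (_ * _)%E.
apply: eq_big_seq => v; rewrite mem_undup => vV.
by have -> : v == u = false by apply: contraNF uV => /eqP <-.
Qed.

Lemma integral_fibers_eq (K : Omega -> 'I_b) (f g : Omega -> \bar R) :
  (forall i, measurable (K @^-1` [set i])) ->
  measurable_fun setT f -> measurable_fun setT g ->
  (forall w, 0 <= f w)%E -> (forall w, 0 <= g w)%E ->
  (forall i, \int[P]_(w in K @^-1` [set i]) f w =
             \int[P]_(w in K @^-1` [set i]) g w)%E ->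
  (\int[P]_w f w = \int[P]_w g w)%E.
Proof.
move=> mK mf mg f0 g0 fg.
have cover : [set: Omega] = \big[setU/set0]_(i <- enum 'I_b) (K @^-1` [set i]).
  rewrite -bigcup_seq; apply/seteqP; split=> // w _.
  by exists (K w) => //=; rewrite mem_enum.
have tr : trivIset [set` enum 'I_b] (fun i => K @^-1` [set i]).
  by move=> i j _ _ [w [/= <- <-]].
rewrite cover !ge0_integral_bigsetU ?enum_uniq //; last 2 first.
- exact: measurable_funTS.
- exact: measurable_funTS.
by apply: eq_bigr.
Qed.

Fixpoint level n : seq (vertex b) :=
  if n is n'.+1 then [seq rcons u k | u <- level n', k <- enum 'I_b]
  else [:: [::]].

Lemma mem_level n v : (v \in level n) = (size v == n).
Proof.
elim: n v => [|n IH] v; first by rewrite inE size_eq0.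
apply/allpairsP/idP => [[[u k] [/= un _ ->]]|].
  by rewrite size_rcons eqSS -IH.
case/lastP: v => [//|u k]; rewrite size_rcons eqSS -IH => un.
by exists (u, k); rewrite /= mem_enum.
Qed.

Lemma level_uniq n : uniq (level n).
Proof.
elim: n => //= n IH; apply: allpairs_uniq => //; first exact: enum_uniq.
by move=> [u k] [u' k'] _ _ /rcons_inj [-> ->].
Qed.

Lemma size_level n : size (level n) = (b ^ n)%N.
Proof. by elim: n => //= n IH; rewrite size_allpairs IH size_enum_ord expnSr. Qed.

Lemma big_level {V : zmodType} n (F : vertex b -> V) :
  \sum_(v <- level n.+1) F v = \sum_(u <- level n) \sum_k F (rcons u k).
Proof.
by rewrite /= big_allpairs_dep /=; apply: eq_bigr => u _; rewrite big_enum.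
Qed.

(** Almost surely the path product of [v], but written with the sibling
    families and the colours, so that it is visibly measurable with respect to
    everything away from a vertex that is at least as deep as [v]. *)
Definition path_label (v : vertex b) (w : Omega) : R :=
  \prod_(i < size v) tnth (edges (take i v) w) (c (take i.+1 v) w).

Lemma path_label_rcons u k w : path_label (rcons u k) w =
  path_label u w * tnth (edges u w) (c (rcons u k) w).
Proof.
have E v : path_label v w =
    \prod_(0 <= i < size v) tnth (edges (take i v) w) (c (take i.+1 v) w).
  by rewrite big_mkord.
rewrite !E size_rcons.
rewrite big_nat_recr //=; congr (_ * _); last first.
  by rewrite -cats1 take_size_cat // take_oversize // size_cat addn1.
apply: eq_big_nat => i /= iu; rewrite -cats1 !takel_cat //; exact: ltnW.
Qed.

Section Away.
Variable u : vertex b.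
Let T1 := g_sigma_algebraType (away_from u).

Lemma away_colour v i : (measurable : set (set T1)) (c v @^-1` [set i]).
Proof.
apply: sub_sigma_algebra; exists [::], (fun=> setT), (c v @^-1` [set i]); split=> //.
  exact: colour_algebra_colour.
by rewrite [X in _ `&` X](_ : _ = setT) ?setIT //; apply/seteqP; split.
Qed.

Lemma away_edges v : v != u -> measurable_fun [set: T1] (edges v).
Proof.
move=> vu _ B mB; rewrite setTI; apply: sub_sigma_algebra.
exists [:: v], (fun=> B), setT; split=> //.
- by rewrite inE eq_sym.
- exact: (@measurableT _ (g_sigma_algebraType
    [set A | exists u i, A = c u @^-1` [set i]])).
rewrite setTI; apply/seteqP; split=> w /=; first by move=> ? ? /[!inE] /eqP ->.
by apply; rewrite inE.
Qed.

Lemma away_path_label v : (size v <= size u)%N ->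
  measurable_fun [set: T1] (path_label v).
Proof.
move=> vu; apply: measurable_prod => i _.
apply: (@measurable_fun_select _ T1 _ _ _ (c (take i.+1 v))
  (fun k w => tnth (edges (take i v) w) k : R)) => k.
  exact: away_colour.
apply: (measurableT_comp (measurable_tnthR k)).
apply: away_edges; apply: contraTneq vu => <-.
by rewrite size_take ltn_ord -ltnNge ltn_ord.
Qed.

Lemma measurable_fun_away {d2} {T2 : measurableType d2} (f : Omega -> T2) :
  measurable_fun [set: T1] f -> measurable_fun setT f.
Proof.
move=> mf _ Y mY; apply: (@away_from_measurable u).
by have := mf measurableT Y mY.
Qed.

End Away.

Lemma measurable_path_label v : measurable_fun setT (path_label v).
Proof. by apply: (@measurable_fun_away v); exact: away_path_label. Qed.
(** * One generation *)

(** The nonlinear operator of the branching recursion, acting on [exp (- phi)]. *)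
Definition branch (phi : 'I_b -> R -> R) (i : 'I_b) (z : R) : \bar R :=
  (\int[P']_x (expR (- \sum_j phi j (z * xi i j x)))%:E)%E.

Lemma branch_ge0 phi i z : (0 <= branch phi i z)%E.
Proof. by apply: integral_ge0 => x _; rewrite lee_fin expR_ge0. Qed.

Lemma measurable_branch phi i : (forall j, measurable_fun setT (phi j)) ->
  measurable_fun setT (branch phi i).
Proof.
move=> mphi.
apply: (@measurable_fun_fubini_tonelli_F _ _ R Omega' R P'
  (fun zx => (expR (- \sum_j phi j (zx.1 * xi i j zx.2)))%:E)).
  apply/measurable_EFinP; apply: measurableT_comp => //.
  apply: measurableT_comp => //; apply: measurable_sum => j.
  apply: measurableT_comp => //; apply: measurable_funM => //.
  exact: (measurableT_comp (measurable_funP (xi i j))).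
by move=> zx; rewrite lee_fin expR_ge0.
Qed.

(** On the event that [u] has colour [i] the family below [u] is a copy of the
    row [i] of [xi] that is independent of [H] and of the label of [u]. *)
Lemma integral_one_vertex (phi : 'I_b -> R -> R) u (H : Omega -> \bar R) :
  (forall j, measurable_fun setT (phi j)) ->
  measurable_fun [set: g_sigma_algebraType (away_from u)] H ->
  (forall w, 0 <= H w)%E ->
  (\int[P]_w (H w * (expR (- \sum_j phi j (path_label u w * tnth (edges u w) j)))%:E)
   = \int[P]_w (H w * branch phi (c u w) (path_label u w)))%E.
Proof.
move=> mphi mH H0.
pose T1 := g_sigma_algebraType (away_from u).
have mX : measurable_fun [set: T1] (path_label u) by exact: away_path_label.
pose f (z : T1 * b.-tuple (measurableTypeR R)) : \bar R :=
  (H z.1 * (expR (- \sum_j phi j (path_label u z.1 * tnth z.2 j)))%:E)%E.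
have mf : measurable_fun setT f.
  apply: emeasurable_funM; first exact: measurableT_comp mH measurable_fst.
  apply/measurable_EFinP; apply: measurableT_comp => //.
  apply: measurableT_comp => //; apply: measurable_sum => j.
  apply: measurableT_comp => //; apply: measurable_funM.
    exact: measurableT_comp mX measurable_fst.
  exact: measurableT_comp (measurable_tnthR j) measurable_snd.
have f0 z : (0 <= f z)%E by rewrite mule_ge0 // lee_fin expR_ge0.
have mfe : measurable_fun setT (fun w => f (w, edges u w)).
  apply: emeasurable_funM; first exact: measurable_fun_away mH.
  apply/measurable_EFinP; apply: measurableT_comp => //.
  apply: measurableT_comp => //; apply: measurable_sum => j.
  apply: measurableT_comp => //; apply: measurable_funM.
    exact: measurable_path_label.
  exact: measurableT_comp (measurable_tnthR j) (@measurable_edges u).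
have mHb : measurable_fun setT (fun w => H w * branch phi (c u w) (path_label u w))%E.
  apply: emeasurable_funM; first exact: measurable_fun_away mH.
  apply: (measurable_fun_select (K := c u)
    (f := fun i w => branch phi i (path_label u w))) => i.
    exact: (colour_measurable hc).
  exact: (measurableT_comp (measurable_branch i mphi) (measurable_path_label u)).
apply: (integral_fibers_eq (K := c u)) => //.
- by move=> i; exact: (colour_measurable hc).
- by move=> w; rewrite mule_ge0 // lee_fin expR_ge0.
- by move=> w; rewrite mule_ge0 // branch_ge0.
move=> i.
have mD : measurable (c u @^-1` [set i]) by exact: (colour_measurable hc).
rewrite (freezing mD (@away_from_measurable u) (@measurable_edges u)
  (@measurable_xi_row i) (@edges_independent u i) mf f0).
apply: eq_integral => w /[!inE] /= wi.
rewrite /f /= ge0_integralZl //.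
- congr (_ * _)%E; rewrite /branch wi; apply: eq_integral => x _.
  by congr (expR (- _))%:E; apply: eq_bigr => j _; rewrite tnth_mktuple.
- apply/measurable_EFinP; apply: measurableT_comp => //.
  apply: measurableT_comp => //; apply: measurable_sum => j.
  apply: measurableT_comp => //; apply: measurable_funM => //.
  exact: measurableT_comp (measurable_tnthR j) (@measurable_xi_row i).

Qed.


(** The vertices of one level are integrated out one at a time: when it is the
    turn of [u], the factors of all the others are measurable away from [u]. *)
Lemma generation_replace (phi : 'I_b -> R -> R) n (s1 s2 : seq (vertex b)) :
  (forall j, measurable_fun setT (phi j)) ->
  uniq (s1 ++ s2) -> (forall u, u \in s1 ++ s2 -> size u = n) ->
  (\int[P]_w ((\prod_(u <- s1) branch phi (c u w) (path_label u w)) *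
     \prod_(u <- s2)
        (expR (- \sum_j phi j (path_label u w * tnth (edges u w) j)))%:E)
   = \int[P]_w \prod_(u <- s1 ++ s2) branch phi (c u w) (path_label u w))%E.
Proof.
move=> mphi; elim: s2 s1 => [|u s2 IH] s1.
  by rewrite cats0 => _ _; apply: eq_integral => w _; rewrite big_nil mule1.
rewrite -cat_rcons => us sn; rewrite -IH //.
pose br v w := branch phi (c v w) (path_label v w).
pose ex v w : \bar R :=
  (expR (- \sum_j phi j (path_label v w * tnth (edges v w) j)))%:E.
pose T1 := g_sigma_algebraType (away_from u).
have br0 v w : (0 <= br v w)%E by exact: branch_ge0.
have ex0 v w : (0 <= ex v w)%E by rewrite lee_fin expR_ge0.
have su v : v \in s1 ++ u :: s2 -> size v = size u.
  by move=> vs; rewrite (sn v) -?(sn u) // cat_rcons // mem_cat mem_head orbT.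
have mX v : v \in s1 ++ u :: s2 -> measurable_fun [set: T1] (path_label v).
  by move=> /su vu; apply: away_path_label; rewrite vu.
have mbr v : v \in s1 -> measurable_fun [set: T1] (br v).
  move=> vs; apply: (@measurable_fun_select _ T1 _ _ _ (c v)
    (fun i w => branch phi i (path_label v w))) => i; first exact: away_colour.
  apply: (measurableT_comp (measurable_branch i mphi)).
  by apply: mX; rewrite mem_cat vs.
have mex v : v \in s2 -> measurable_fun [set: T1] (ex v).
  move=> vs; apply/measurable_EFinP; apply: measurableT_comp => //.
  apply: measurableT_comp => //; apply: measurable_sum => j.
  apply: measurableT_comp => //; apply: measurable_funM.
    by apply: mX; rewrite mem_cat inE vs !orbT.
  apply: (measurableT_comp (measurable_tnthR j)); apply: away_edges.
  apply: contraTneq us => vu.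
  by rewrite cat_rcons cat_uniq /= -vu vs /= !andbF.
have mprod (s : seq (vertex b)) (F : vertex b -> T1 -> \bar R) :
    (forall v, v \in s -> measurable_fun [set: T1] (F v)) ->
    measurable_fun [set: T1] (fun w => \prod_(v <- s) F v w)%E.
  elim: s => [|v s IHs] mF.
    by under eq_fun do rewrite big_nil; exact: measurable_cst.
  under eq_fun do rewrite big_cons; apply: emeasurable_funM.
    by apply: mF; rewrite mem_head.
  by apply: IHs => v' vs; apply: mF; rewrite inE vs orbT.
pose H w := ((\prod_(v <- s1) br v w) * \prod_(v <- s2) ex v w)%E.
have pr0 (s : seq (vertex b)) (F : vertex b -> Omega -> \bar R) w :
  (forall v w, 0 <= F v w)%E -> (0 <= \prod_(v <- s) F v w)%E.
  by move=> F0; elim/big_ind: _ => // x y; exact: mule_ge0.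
have mH : measurable_fun [set: T1] H.
  by apply: emeasurable_funM; exact: mprod.
have H0 w : (0 <= H w)%E by rewrite mule_ge0 // pr0.
transitivity (\int[P]_w (H w * ex u w))%E.
  apply: eq_integral => w _; rewrite big_cons /H -/(br _ _) -/(ex _ _).
  by rewrite [X in (_ * X)%E]muleC muleA.
rewrite integral_one_vertex //; apply: eq_integral => w _.
by rewrite big_rcons /= /H -/(br _ _) muleAC.
Qed.

(** Only finitely many colourings of the first levels have to be excluded, as
    words of bounded length form a finite type. *)
Lemma ae_proper :
  {ae P, forall w, forall u, injective (fun k => c (child u k) w)}.
Proof.
suff H n : {ae P, forall w, forall u, size u = n -> injective (fun k => c (child u k) w)}.
  have /ae_foralln := H; apply: filterS => w Hw u; exact: (Hw (size u)).
pose B := n.+1.-bseq 'I_b.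
pose ext (f : {ffun B -> 'I_b}) (v : vertex b) := f (insub_bseq n.+1 v).
have insK (v : vertex b) : (size v <= n.+1)%N -> val (insub_bseq n.+1 v) = v.
  by move=> sv; rewrite /insub_bseq val_insubd sv.
have : {ae P, forall w, forall f, ~ proper_level n (ext f) -> ~ agree_upto c (ext f) n.+1 w}.
  apply: filter_forall => f.
  have [pf|npf] := pselect (proper_level n (ext f)); first exact: aeW.
  have mA : measurable (agree_upto c (ext f) n.+1).
    have := @measurable_finite_family _ _ _ _ (fun (v : B) w => c (val v) w)
      (fun f' => f' = f) (fun v i => colour_measurable hc (val v) i).
    congr measurable; apply/seteqP; split=> w /=.
      move=> e v sv; have := congr1 (fun g : {ffun B -> 'I_b} => g (insub_bseq n.+1 v)) e.
      by rewrite ffunE insK.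
    move=> e; apply/ffunP => v; rewrite ffunE e.
      rewrite /ext; congr (f _); apply/val_inj.
      by rewrite insK // size_bseq.
    exact: size_bseq.
  exists (agree_upto c (ext f) n.+1); split=> //.
    by rewrite (colour_step hc) asboolF // mule0.
  by move=> w /= /not_implyP [_ /contrapT].
apply: filterS => w Hw u un.
have agr : agree_upto c (ext [ffun v : B => c (val v) w]) n.+1 w.
  by move=> v sv; rewrite /ext ffunE insK.
have pr : proper_level n (ext [ffun v : B => c (val v) w]).
  by apply: contrapT => np; exact: Hw np agr.
move=> k1 k2 e; apply: (pr u un); rewrite /= /ext !ffunE !insK //.
- by rewrite size_rcons un.
- by rewrite size_rcons un.
Qed.

Lemma ae_edges_gt0 : {ae P, forall w, forall u j, 0 < tnth (edges u w) j}.
Proof.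
suff H u : {ae P, forall w, forall j, 0 < tnth (edges u w) j}.
  have : {ae P, forall w, forall n (u : vertex b), unpickle n = Some u ->
      forall j, 0 < tnth (edges u w) j}.
    apply/ae_foralln => n.
    have [[u nu]|nu] := pselect (exists u : vertex b, unpickle n = Some u).
      by apply: filterS (H u) => w Hu u'; rewrite nu => -[<-].
    by apply: aeW => w u hu; case: nu; exists u.
  by apply: filterS => w Hw u; apply: (Hw (pickle u)); rewrite pickleK.
apply: filter_forall => j.
pose C := [set t : b.-tuple (measurableTypeR R) | (tnth t j : R) <= 0].
have mC : measurable C.
  rewrite -[C]setTI; have := @measurable_tnthR R b j measurableT `]-oo, 0]%classic.
  rewrite (_ : C = (fun t : b.-tuple (measurableTypeR R) => tnth t j : R) @^-1` `]-oo, 0]).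
    by apply; exact: measurable_itv.
  by apply/seteqP; split=> t /=; rewrite in_itv.
have cT : colour_algebra c setT.
  exact: (@measurableT _ (g_sigma_algebraType
    [set A | exists u i, A = c u @^-1` [set i]])).
have mE : measurable (edges u @^-1` C).
  by rewrite -[X in measurable X]setTI; exact: measurable_edges.
exists (edges u @^-1` C); split=> //; last first.
  by move=> w /= /negP; rewrite -leNgt.
have := hzeta (U := [:: u]) (B := fun=> C) isT (fun=> mC) cT.
rewrite setTI (_ : [set w | _] = edges u @^-1` C); last first.
  by apply/seteqP; split=> w /=; [apply; rewrite inE|move=> ? ? /[!inE] /eqP ->].
move=> ->; rewrite integral0_eq // => w _; rewrite big_seq1.
have := xi_gt0 (c u w) j => -[N [mN N0 hN]].
apply: subset_measure0 N0 => //.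
  rewrite -[X in measurable X]setTI; exact: measurable_xi_row.
move=> x /=; rewrite /C /= tnth_mktuple => h; apply: hN => /=.
by apply/negP; rewrite -leNgt.
Qed.

Lemma ae_path_label_gt0 : {ae P, forall w, forall v, 0 < path_label v w}.
Proof.
apply: filterS ae_edges_gt0 => w Hw v; apply: prodr_gt0 => i _.
exact: Hw.
Qed.

Lemma ae_path_product : {ae P, forall w, forall v,
  path_product zeta v w = path_label v w}.
Proof.
apply: filterS ae_proper => w Hw v; apply: eq_bigr => i _.
rewrite (take_nth c0) //; set u := take i v; set k := nth _ _ _.
rewrite tnth_mktuple; congr (zeta (rcons u _) w).
rewrite /child_of_colour; case: pickP => [k' /= /eqP /Hw -> //|/(_ k)].
by rewrite eqxx.
Qed.

Definition level_sum (phi : 'I_b -> R -> R) n w :=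
  \sum_(v <- level n) phi (c v w) (path_label v w).

Lemma measurable_level_sum phi n : (forall j, measurable_fun setT (phi j)) ->
  measurable_fun setT (level_sum phi n).
Proof.
move=> mphi; apply: measurable_sum => v.
apply: (measurable_fun_select (K := c v) (f := fun i w => phi i (path_label v w))).
  by move=> i; exact: (colour_measurable hc).
by move=> i; exact: measurableT_comp (measurable_path_label v).
Qed.

Lemma level_sum0 phi w : level_sum phi 0 w = phi c0 1.
Proof. by rewrite /level_sum big_seq1 (colour_root hc) /path_label big_ord0. Qed.

(** Almost surely the children of each vertex carry every colour once, so that
    a sum over the children is a sum over the colours. *)
Lemma generation_integral phi n : (forall j, measurable_fun setT (phi j)) ->
  (\int[P]_w (expR (- level_sum phi n.+1 w))%:E =
   \int[P]_w \prod_(u <- level n) branch phi (c u w) (path_label u w))%E.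
Proof.
move=> mphi.
have un : uniq ([::] ++ level n) by rewrite level_uniq.
rewrite -(@generation_replace phi n [::] (level n)) //; last first.
  by move=> u /=; rewrite mem_level => /eqP.
pose E u w := expR (- \sum_j phi j (path_label u w * tnth (edges u w) j)).
have prodE w : (\prod_(u <- level n) (E u w)%:E)%E =
    (expR (- \sum_(u <- level n) \sum_j phi j (path_label u w * tnth (edges u w) j)))%:E.
  rewrite -sumrN expR_sum.
  by elim: (level n) => [|u s IH]; rewrite ?big_nil // !big_cons IH EFinM.
apply: ge0_ae_eq_integral => //.
- apply/measurable_EFinP; apply: measurableT_comp => //.
  by apply: measurableT_comp => //; exact: measurable_level_sum.
- apply: (eq_measurable_fun (fun w => (expR (- \sum_(u <- level n) \sum_j
    phi j (path_label u w * tnth (edges u w) j)))%:E)).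
    by move=> w _; rewrite big_nil mul1e prodE.
  apply/measurable_EFinP; apply: measurableT_comp => //.
  apply: measurableT_comp => //; apply: measurable_sum => u.
  apply: measurable_sum => j.
  apply: measurableT_comp => //; apply: measurable_funM.
    exact: measurable_path_label.
  exact: measurableT_comp (measurable_tnthR j) (@measurable_edges u).
- by move=> w _; rewrite big_nil mul1e prodE lee_fin expR_ge0.
apply: filterS ae_proper => w Hw _; rewrite big_nil mul1e prodE.
congr (expR (- _))%:E; rewrite /level_sum big_level; apply: eq_bigr => u _.
rewrite [RHS](reindex_inj (Hw u)) /=; apply: eq_bigr => k _.
by rewrite path_label_rcons.
Qed.

Lemma measurable_branches phi n : (forall j, measurable_fun setT (phi j)) ->
  measurable_fun setT
    (fun w => \prod_(u <- level n) branch phi (c u w) (path_label u w))%E.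
Proof.
move=> mphi; elim: (level n) => [|u s IH].
  by under eq_fun do rewrite big_nil; exact: measurable_cst.
under eq_fun do rewrite big_cons; apply: emeasurable_funM IH.
apply: (measurable_fun_select (K := c u)
  (f := fun i w => branch phi i (path_label u w))) => i.
  exact: (colour_measurable hc).
exact: (measurableT_comp (measurable_branch i mphi) (measurable_path_label u)).
Qed.

Lemma prod_expR_level_sum psi n w :
  (\prod_(u <- level n) (expR (- psi (c u w) (path_label u w)))%:E)%E =
  (expR (- level_sum psi n w))%:E.
Proof.
rewrite /level_sum -sumrN expR_sum.
by elim: (level n) => [|u s IH]; rewrite ?big_nil // !big_cons IH EFinM.
Qed.

(** Pointwise bounds on the branching operator compare the exponential
    functionals of consecutive levels, and can then be iterated. *)
Lemma generation_le (phi psi : 'I_b -> R -> R) n :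
  (forall j, measurable_fun setT (phi j)) -> (forall j, measurable_fun setT (psi j)) ->
  (forall i (z : R), 0 < z -> (branch phi i z <= (expR (- psi i z))%:E)%E) ->
  (\int[P]_w (expR (- level_sum phi n.+1 w))%:E <=
   \int[P]_w (expR (- level_sum psi n w))%:E)%E.
Proof.
move=> mphi mpsi le; rewrite generation_integral //.
apply: ae_ge0_le_integral => //.
- by move=> w _; elim/big_ind: _ => // [x y|u _]; [exact: mule_ge0|exact: branch_ge0].
- exact: measurable_branches.
- apply/measurable_EFinP; apply: measurableT_comp => //.
  by apply: measurableT_comp => //; exact: measurable_level_sum.
apply: filterS ae_path_label_gt0 => w Hw _; rewrite -prod_expR_level_sum.
suff /andP[] : (0 <= \prod_(u <- level n) branch phi (c u w) (path_label u w) <=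
    \prod_(u <- level n) (expR (- psi (c u w) (path_label u w)))%:E)%E by [].
apply: (big_ind2 (fun x y => 0 <= x <= y)%E) => [|x1 x2 y1 y2|u _].
- by rewrite lexx lee01.
- by move=> /andP[x0 xy] /andP[y0 yz]; rewrite mule_ge0 //= lee_pmul.
- by rewrite branch_ge0 le.
Qed.

Lemma generation_ge (phi psi : 'I_b -> R -> R) n :
  (forall j, measurable_fun setT (phi j)) -> (forall j, measurable_fun setT (psi j)) ->
  (forall i (z : R), 0 < z -> ((expR (- psi i z))%:E <= branch phi i z)%E) ->
  (\int[P]_w (expR (- level_sum psi n w))%:E <=
   \int[P]_w (expR (- level_sum phi n.+1 w))%:E)%E.
Proof.
move=> mphi mpsi le; rewrite generation_integral //.
apply: ae_ge0_le_integral => //.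
- apply/measurable_EFinP; apply: measurableT_comp => //.
  by apply: measurableT_comp => //; exact: measurable_level_sum.
- by move=> w _; elim/big_ind: _ => // [x y|u _]; [exact: mule_ge0|exact: branch_ge0].
- exact: measurable_branches.
apply: filterS ae_path_label_gt0 => w Hw _; rewrite -prod_expR_level_sum.
suff /andP[] : (0 <= \prod_(u <- level n) (expR (- psi (c u w) (path_label u w)))%:E <=
    \prod_(u <- level n) branch phi (c u w) (path_label u w))%E by [].
apply: (big_ind2 (fun x y => 0 <= x <= y)%E) => [|x1 x2 y1 y2|u _].
- by rewrite lexx lee01.
- by move=> /andP[x0 xy] /andP[y0 yz]; rewrite mule_ge0 //= lee_pmul.
- by rewrite lee_fin expR_ge0 le.
Qed.

(** * Sums over the levels *)

Fixpoint upto N : seq (vertex b) :=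
  if N is N'.+1 then upto N' ++ level N' else [::].

Lemma mem_upto N v : (v \in upto N) = (size v < N)%N.
Proof.
elim: N => [|N IH] /=; first by rewrite in_nil ltn0.
by rewrite mem_cat IH mem_level ltnS [RHS]leq_eqVlt orbC.
Qed.

Lemma upto_uniq N : uniq (upto N).
Proof.
elim: N => //= N IH; rewrite cat_uniq IH level_uniq andbT; apply/hasPn => v.
by rewrite mem_level mem_upto => /eqP ->; rewrite ltnn.
Qed.

Lemma big_upto N (F : vertex b -> R) :
  \sum_(v <- upto N) F v = \sum_(n < N) \sum_(v <- level n) F v.
Proof.
by elim: N => [|N IH]; rewrite ?big_nil ?big_ord0 //= big_cat IH big_ord_recr.
Qed.

Lemma level_sums_le_esum N (F : vertex b -> R) :
  ((\sum_(n < N) \sum_(v <- level n) F v)%:E <= \esum_(v in setT) (F v)%:E)%E.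
Proof.
apply: ereal_sup_ubound; exists [set` upto N].
  by split; [exact: finite_seq|exact: subsetT].
by rewrite -fsbig_seq ?upto_uniq // sumEFin big_upto.
Qed.

Lemma esum_le_level_sums (F : vertex b -> R) (K : R) : (forall v, 0 <= F v) ->
  (forall N, \sum_(n < N) \sum_(v <- level n) F v <= K) ->
  (\esum_(v in setT) (F v)%:E <= K%:E)%E.
Proof.
move=> F0 FK; apply: ge_ereal_sup => _ [A [finA _] <-].
have /finite_seqP[l Al] := finA.
pose N := (\max_(v <- l) size v).+1.
apply: (@le_trans _ _ (\sum_(v \in [set` upto N]) (F v)%:E)%E).
  apply: lee_fsum_nneg_subset; [exact: finA|exact: finite_seq| |]; last first.
    by move=> v _; rewrite lee_fin.
  move=> v vA; rewrite mem_setE mem_upto ltnS.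
  by apply: leq_bigmax_seq => //; move: vA; rewrite Al mem_setE.
by rewrite -fsbig_seq ?upto_uniq // sumEFin big_upto lee_fin.
Qed.

(** * The subcritical case *)

Section Subcritical.
Variables (s th : R) (x : 'I_b -> R).
Hypothesis s01 : 0 < s <= 1.
Hypothesis th01 : 0 <= th < 1.
Hypothesis x0 : forall i, 0 < x i.
Hypothesis finite_moment : forall i j, (moment P' xi s i j < +oo)%E.
Hypothesis subinvariant :
  forall i, \sum_j fine (moment P' xi s i j) * x j <= th * x i.

(** The level sums of [phi 1] weight the [s]-th powers of the path products by
    the subinvariant vector, so that one generation multiplies their conditional
    expectation by at most [th]; the parameter [la] absorbs these factors. *)
Let phi (la : R) (j : 'I_b) (z : R) : R := la * x j * z `^ s.

Let measurable_phi la j : measurable_fun setT (phi la j).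
Proof. by apply: measurable_funM => //; exact: measurable_powR. Qed.

Let momentE i j : (\int[P']_t (xi i j t `^ s)%:E = (fine (moment P' xi s i j))%:E)%E.
Proof.
have := finite_moment i j; rewrite /moment unlock => h; rewrite fineK //.
by rewrite ge0_fin_numE //; apply: integral_ge0 => t _; rewrite lee_fin powR_ge0.
Qed.

Let measurable_phi_xi la i j z : measurable_fun setT (fun t => phi la j (z * xi i j t)).
Proof.
by apply: (measurableT_comp (measurable_phi la j)); exact: measurable_funM.
Qed.

(** Jensen's inequality for the exponential, read off its tangent line at the
    mean [m] so that only integrals of nonnegative functions occur. *)
Let branch_phi_ge la i z : 0 <= la -> 0 < z ->
  ((expR (- phi (la * th) i z))%:E <= branch (phi la) i z)%E.
Proof.
move=> la0 z0; pose m := \sum_j la * x j * (z `^ s) * fine (moment P' xi s i j).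
pose Y t := \sum_j phi la j (z * xi i j t).
have phi0 j y : 0 <= phi la j y by rewrite !mulr_ge0 ?powR_ge0 // ltW.
have Y0 t : 0 <= Y t by apply: sumr_ge0.
have mY : measurable_fun setT Y by apply: measurable_sum.
have YE : (\int[P']_t (Y t)%:E = m%:E)%E.
  rewrite (eq_integral (fun t => \sum_j (phi la j (z * xi i j t))%:E)%E); last first.
    by move=> t _; rewrite sumEFin.
  rewrite ge0_integral_sum //; last 2 first.
  - by move=> j; exact/measurable_EFinP.
  - by move=> j t _; rewrite lee_fin.
  rewrite /m -sumEFin; apply: eq_bigr => j _; rewrite EFinM -momentE.
  have k0 : 0 <= la * x j * z `^ s by exact: phi0.
  rewrite -ge0_integralZl //; last 2 first.
  - by apply/measurable_EFinP; exact: (measurableT_comp (measurable_powR s)).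
  - by move=> t _; rewrite lee_fin powR_ge0.
  apply: ge0_ae_eq_integral => //.
  - exact/measurable_EFinP.
  - apply: measurable_funeM; apply/measurable_EFinP.
    exact: (measurableT_comp (measurable_powR s)).
  - by move=> t _; rewrite lee_fin.
  - by move=> t _; rewrite mule_ge0 // lee_fin powR_ge0.
  apply: filterS (xi_gt0 i j) => t t0 _.
  by rewrite -EFinM /phi powRM ?(ltW z0) ?(ltW t0) // mulrA.
have m_le : m <= la * th * x i * z `^ s.
  have -> : m = la * z `^ s * \sum_j fine (moment P' xi s i j) * x j.
    by rewrite /m mulr_sumr; apply: eq_bigr => j _; ring.
  have -> : la * th * x i * z `^ s = la * z `^ s * (th * x i) by ring.
  by rewrite ler_wpM2l // mulr_ge0 // powR_ge0.
apply: (@le_trans _ _ (expR (- m))%:E).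
  by rewrite lee_fin ler_expR lerN2.
have : ((expR (- m) * (1 + m))%:E <= branch (phi la) i z + (expR (- m))%:E * m%:E)%E.
  rewrite -YE -ge0_integralZl ?lee_fin ?expR_ge0 //; last 2 first.
  - exact/measurable_EFinP.
  - by move=> t _; rewrite lee_fin.
  have mE : measurable_fun setT (fun t => (expR (- Y t))%:E).
    by apply/measurable_EFinP; apply: measurableT_comp => //; exact: measurableT_comp.
  rewrite -ge0_integralD //; last 2 first.
  - by move=> t _; rewrite mule_ge0 // lee_fin ?expR_ge0.
  - by apply: measurable_funeM; exact/measurable_EFinP.
  rewrite -[leLHS](integral_probability_cst P').
  have m0 : 0 <= m.
    apply: sumr_ge0 => j _; rewrite mulr_ge0 ?phi0 // fine_ge0 // /moment unlock.
    by apply: integral_ge0 => t _; rewrite lee_fin powR_ge0.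
  apply: ge0_le_integral => //.
  - by move=> t _; rewrite lee_fin mulr_ge0 ?expR_ge0 // addr_ge0.
  - by apply: emeasurable_funD => //; apply: measurable_funeM; exact/measurable_EFinP.
  - move=> t _; rewrite -EFinM -EFinD lee_fin.
    have -> : - Y t = - m + (m - Y t) by ring.
    rewrite expRD -mulrDr ler_pM2l ?expR_gt0 //.
    by have := expR_ge1Dx (m - Y t); lra.
by rewrite -leeBlDr // -EFinM -EFinB mulrDr mulr1 addrK.
Qed.

Let level_exp_ge n la : 0 <= la ->
  ((expR (- (la * th ^+ n * x c0)))%:E <=
   \int[P]_w (expR (- level_sum (phi la) n w))%:E)%E.
Proof.
have th0 : 0 <= th by case/andP: th01.
elim: n la => [|n IH] la la0.
  rewrite (eq_integral (cst (expR (- (la * x c0)))%:E)); last first.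
    by move=> w _; rewrite level_sum0 /phi powR1 mulr1.
  by rewrite /cst integral_probability_cst expr0 mulr1.
apply: le_trans (_ : (_ <= \int[P]_w (expR (- level_sum (phi (la * th)) n w))%:E)%E) _.
  by rewrite exprS mulrA; apply: IH; rewrite mulr_ge0.
by apply: generation_ge => // i z z0; exact: branch_phi_ge.
Qed.

Let Z n w := level_sum (phi 1) n w.

Let Z_ge0 n w : 0 <= Z n w.
Proof. by apply: sumr_ge0 => v _; rewrite !mulr_ge0 ?powR_ge0 // ltW. Qed.

Let defect n w : R := 1 - expR (- Z n w).

Let defect_ge0 n w : 0 <= defect n w.
Proof. by rewrite subr_ge0 -expR0 ler_expR oppr_le0. Qed.

Let measurable_defect n : measurable_fun setT (defect n).
Proof.
apply: measurable_funB => //; apply: measurableT_comp => //.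
by apply: measurableT_comp => //; exact: measurable_level_sum.
Qed.

Let integral_defect n : (\int[P]_w (defect n w)%:E <= (th ^+ n * x c0)%:E)%E.
Proof.
have mE : measurable_fun setT (fun w => (expR (- Z n w))%:E).
  apply/measurable_EFinP; apply: measurableT_comp => //.
  by apply: measurableT_comp => //; exact: measurable_level_sum.
have sum1 : (\int[P]_w (defect n w)%:E + \int[P]_w (expR (- Z n w))%:E = 1)%E.
  rewrite -ge0_integralD //; first last.
  - exact/measurable_EFinP.
  - by move=> w _; rewrite lee_fin.
  rewrite -[RHS](integral_probability_cst P); apply: eq_integral => w _.
  by rewrite -EFinD /defect subrK.
have := @level_exp_ge n 1 ler01; rewrite mul1r => h.
have : (\int[P]_w (defect n w)%:E + (expR (- (th ^+ n * x c0)))%:E <= 1)%E.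
  by rewrite -sum1; exact: leeD2l.
rewrite -leeBrDr // => /le_trans; apply.
rewrite -EFinB lee_fin; have := expR_ge1Dx (- (th ^+ n * x c0)); lra.
Qed.

Let ae_defect_summable :
  {ae P, forall w, (\sum_(n <oo) (defect n w)%:E)%E \is a fin_num}.
Proof.
have [th0 th1] : 0 <= th /\ th < 1 by case/andP: th01.
have md n : measurable_fun setT (fun w => (defect n w)%:E) by exact/measurable_EFinP.
have d0 n w : (0 <= (defect n w)%:E)%E by rewrite lee_fin.
have mS : measurable_fun setT (fun w => \sum_(n <oo) (defect n w)%:E)%E.
  by apply: ge0_emeasurable_sum => n w.
suff : P.-integrable setT (fun w => \sum_(n <oo) (defect n w)%:E)%E.
  by move=> /integrable_ae => /(_ measurableT); apply: filterS => w; exact.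
apply/integrableP; split=> //.
under eq_integral do rewrite gee0_abs ?nneseries_ge0 //.
rewrite integral_nneseries //.
apply: le_lt_trans (ltry ((1 - th)^-1 * x c0)).
apply: lime_le; first by apply: is_cvg_nneseries => n _ _; exact: integral_ge0.
apply: nearW => N; apply: le_trans (lee_sum _ (fun n _ => integral_defect n)) _.
rewrite sumEFin lee_fin -mulr_suml ler_pM2r // big_mkord.
rewrite -[leRHS]mul1r ler_pdivlMr ?subr_gt0 // mulrC.
have := subrX1 th N; rewrite -opprB -[th - 1]opprB mulNr => /oppr_inj <-.
by rewrite lerBlDr lerDl exprn_ge0.
Qed.

(** The expected values of [defect] decrease geometrically, so the level sums
    [Z] are summable. As [s <= 1], a bound on all [path_label v `^ s] turns
    summability of these powers into summability of the labels. *)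
Lemma subcritical_finite : {ae P, forall w, (total_sum zeta w < +oo)%E}.
Proof.
apply: filterS3 ae_defect_summable ae_path_label_gt0 ae_path_product.
move=> w Sfin X0 pX.
pose a n := defect n w.
pose K := fine (\sum_(n <oo) (a n)%:E)%E.
have Kfin : (\sum_(n <oo) (a n)%:E < +oo)%E by rewrite ltey_eq Sfin.
have aK N : \sum_(n < N) a n <= K.
  rewrite -lee_fin fineK // -sumEFin -(big_mkord xpredT (fun n => (a n)%:E)).
  by apply: nneseries_lim_ge => n _ _; rewrite lee_fin defect_ge0.
have a0 n : 0 <= a n by exact: defect_ge0.
have acvg : a @ \oo --> 0 by exact: nneseries_cvg0.
have [n0 hn0] : exists n0, forall n, (n0 <= n)%N -> a n <= 2^-1.
  have /cvgrPdist_le /(_ 2^-1) := acvg; rewrite invr_gt0 ltr0n => /(_ isT).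
  move=> [n0 _ h]; exists n0 => n /h /=.
  by rewrite sub0r normrN ger0_norm.
(* [Z] is eventually at most twice the defect, hence always at most [C] times it *)
pose C := 2 + \sum_(k < n0) Z k w / a k.
have ZC n : Z n w <= C * a n.
  have quot k : 0 <= Z k w / a k by rewrite divr_ge0.
  have [nn0|nn0] := ltnP n n0.
    have [an0|an0] := eqVneq (a n) 0.
      move: an0 => /eqP; rewrite subr_eq0 eq_sym => /eqP e.
      have : expR (- Z n w) = expR 0 by rewrite e expR0.
      move=> /expR_inj /eqP; rewrite oppr_eq0 => /eqP ->.
      by rewrite mulr_ge0 // addr_ge0 // sumr_ge0.
    rewrite -ler_pdivrMr ?lt_neqAle 1?eq_sym ?an0 ?a0 //.
    rewrite /C (bigD1 (Ordinal nn0)) //= addrA [2 + _]addrC -addrA lerDl.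
    by rewrite addr_ge0 // sumr_ge0.
  apply: (@le_trans _ _ (2 * a n)); last by rewrite ler_wpM2r // lerDl sumr_ge0.
  have := hn0 n nn0; rewrite /a /defect => h.
  have e1 : expR (- Z n w) * (1 + Z n w) <= 1.
    rewrite -[leRHS](expRxMexpNx_1 (Z n w)) mulrC ler_pM2r ?expR_gt0 //.
    exact: expR_ge1Dx.
  have e0 := expR_gt0 (- Z n w); have := Z_ge0 n w; nra.
have C0 : 0 <= C by rewrite addr_ge0 // sumr_ge0 // => k _; rewrite divr_ge0.
have K0 : 0 <= K by have := aK 0%N; rewrite big_ord0.
have [i1 hi1] : exists i, forall j, x i <= x j.
  have [i h] := exists_argmax c0 (fun j => - x j).
  by exists i => j; rewrite -lerN2.
have [s0 s1] : 0 < s /\ s <= 1 by case/andP: s01.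
have termE v : (0 <= x (c v w) * path_label v w `^ s).
  by rewrite mulr_ge0 ?powR_ge0 // ltW.
have ZE n : Z n w = \sum_(v <- level n) x (c v w) * path_label v w `^ s.
  by apply: eq_bigr => v _; rewrite /phi mul1r.
pose D := C * K / x i1.
have aK1 n : a n <= K.
  by apply: le_trans (aK n.+1); rewrite big_ord_recr /= lerDr sumr_ge0.
have XD v : path_label v w `^ s <= D.
  rewrite ler_pdivlMr //.
  apply: (@le_trans _ _ (Z (size v) w)).
    rewrite ZE (big_rem v) /=; last by rewrite mem_level.
    rewrite mulrC -[leLHS]addr0; apply: lerD; last exact: sumr_ge0.
    by rewrite ler_wpM2r ?powR_ge0.
  by apply: le_trans (ZC _) _; rewrite ler_wpM2l.
pose D' := D `^ ((1 - s) / s).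
have XD' v : path_label v w <= D' / x i1 * (x (c v w) * path_label v w `^ s).
  have Xv := X0 v.
  have XE : path_label v w = (path_label v w `^ s) `^ ((1 - s) / s) * path_label v w `^ s.
    rewrite -powRrM [s * _]mulrC -mulrA mulVf ?gt_eqF // mulr1 -powRD.
      by rewrite subrK powRr1 // ltW.
    by apply/implyP => _; rewrite gt_eqF.
  have h1 : (path_label v w `^ s) `^ ((1 - s) / s) <= D'.
    apply: ge0_ler_powR; rewrite ?nnegrE ?powR_ge0 //.
      by rewrite divr_ge0 ?subr_ge0 // ltW.
    exact: le_trans (powR_ge0 _ _) (XD v).
  have h2 : 1 <= (x i1)^-1 * x (c v w) by rewrite mulrC ler_pdivlMr // mul1r.
  rewrite {1}XE mulrA ler_wpM2r ?powR_ge0 // -[leLHS]mulr1 -[leRHS]mulrA.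
  by apply: ler_pM; rewrite ?powR_ge0.
have total : (\esum_(v in [set: vertex b]) (path_label v w)%:E <= (D' / x i1 * (C * K))%:E)%E.
  apply: esum_le_level_sums => [v|N]; first exact: ltW.
  have D'0 : 0 <= D' / x i1 by rewrite divr_ge0 ?powR_ge0 // ltW.
  apply: (@le_trans _ _ (\sum_(n < N) D' / x i1 * Z n w)).
    apply: ler_sum => n _; rewrite ZE mulr_sumr; apply: ler_sum => v _; exact: XD'.
  rewrite -mulr_sumr ler_wpM2l //.
  apply: (@le_trans _ _ (\sum_(n < N) C * a n)); first exact: ler_sum.
  by rewrite -mulr_sumr ler_wpM2l.
rewrite /total_sum (eq_esum (b := fun v => (path_label v w)%:E)); last first.
  by move=> v _; rewrite pX.
exact: le_lt_trans total (ltry _).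
Qed.

End Subcritical.

(** * The supercritical case *)

Section Supercritical.
Variables (h : 'I_b -> R -> R) (C de : R).
Hypothesis b2 : (2 <= b)%N.
Hypothesis mh : forall j, measurable_fun setT (h j).
Hypothesis h_le : forall j z, 0 < z -> 0 <= h j z <= C * z.
Hypothesis de0 : 0 < de.
Hypothesis h_ge : forall j z, 1 <= z -> de <= h j z.
Hypothesis h_branch : forall i z, 0 < z ->
  (branch h i z <= (expR (- h i z))%:E)%E.

Let scaled (ta : R) (j : 'I_b) (z : R) : R := h j (ta * z).

Let measurable_scaled ta j : measurable_fun setT (scaled ta j).
Proof. by apply: (measurableT_comp (mh j)); exact: measurable_funM. Qed.

Let E ta n := (\int[P]_w (expR (- level_sum (scaled ta) n w))%:E)%E.

Let E_nonincreasing ta m n : 0 < ta -> (m <= n)%N -> (E ta n <= E ta m)%E.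
Proof.
move=> ta0 /subnKC <-; elim: (n - m)%N => [|k IH]; first by rewrite addn0.
apply: le_trans IH; rewrite addnS; apply: generation_le => // i z z0.
have := h_branch i (mulr_gt0 ta0 z0); apply: le_trans.
rewrite /branch le_eqVlt; apply/orP; left; apply/eqP.
by apply: eq_integral => x _; congr (expR (- _))%:E; apply: eq_bigr => j _;
  rewrite /scaled mulrA.
Qed.

Let S n w := level_sum (fun _ z => `|z|) n w.

Let S_ge0 n w : 0 <= S n w. Proof. by apply: sumr_ge0. Qed.

Let measurable_S n : measurable_fun setT (S n).
Proof. by apply: measurable_level_sum => j; exact: measurableT_comp. Qed.

Let Y w := (\sum_(n <oo) (S n w)%:E)%E.

Let measurable_Y : measurable_fun setT Y.
Proof.
apply: ge0_emeasurable_sum => [n w _ _|n _]; first by rewrite lee_fin.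
exact/measurable_EFinP.
Qed.

Let F : set Omega := ~` (Y @^-1` [set +oo%E]).

Let mF : measurable F.
Proof.
apply: measurableC; rewrite -[X in measurable X]setTI.
by apply: measurable_Y => //; exact: emeasurable_set1.
Qed.

Let measurable_exp ta n :
  measurable_fun setT (fun w => (expR (- level_sum (scaled ta) n w))%:E).
Proof.
apply/measurable_EFinP; apply: measurableT_comp => //.
by apply: measurableT_comp => //; exact: measurable_level_sum.
Qed.

Let level_sum_scaled_ge0 ta n w : 0 < ta -> (forall v, 0 < path_label v w) ->
  0 <= level_sum (scaled ta) n w.
Proof.
move=> ta0 X0; apply: sumr_ge0 => v _.
by have /andP[] := h_le (c v w) (mulr_gt0 ta0 (X0 v)).
Qed.

(** Where the total sum is finite the level sums tend to 0, and so do those of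
    [h], at any scale [ta]; the exponential functional then tends to 1 there,
    while its integral is nonincreasing in the level. *)
Let prob_finite_le ta m : 0 < ta -> (P F <= E ta m)%E.
Proof.
move=> ta0.
pose f n w : \bar R := (expR (- level_sum (scaled ta) n w))%:E.
have [] // := @dominated_convergence _ _ _ P F mF f (cst 1%E) (cst 1%E).
- by move=> n; apply: measurable_funTS; exact: measurable_exp.
- apply: filterS ae_path_label_gt0 => w X0 Fw.
  apply: cvg_EFin; first exact: nearW.
  have Sw : (Y w < +oo)%E by rewrite ltey; apply/eqP.
  have S0 : (fun n => S n w) @ \oo --> 0 by exact: nneseries_cvg0 Sw.
  apply: (@squeeze_cvgr _ _ _ _ (fun n => 1 - C * ta * S n w) (cst 1)).
  - apply: nearW => n; apply/andP; split; last first.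
      by rewrite /= -expR0 ler_expR oppr_le0 level_sum_scaled_ge0.
    apply: le_trans (expR_ge1Dx _); rewrite lerD2l lerN2 /S /level_sum mulr_sumr.
    apply: ler_sum => v _; rewrite gtr0_norm // -mulrA.
    by have /andP[] := h_le (c v w) (mulr_gt0 ta0 (X0 v)).
  - rewrite -[X in _ --> X]subr0; apply: cvgB; first exact: cvg_cst.
    by rewrite -[X in _ --> X](mulr0 (C * ta)); apply: cvgM => //; exact: cvg_cst.
  - exact: cvg_cst.
- by apply: integrableS (finite_measure_integrable_cst P 1 measurableT).
- apply: filterS ae_path_label_gt0 => w X0 n Fw.
  rewrite gee0_abs ?lee_fin ?expR_ge0 //.
  by rewrite -expR0 ler_expR oppr_le0 level_sum_scaled_ge0.
move=> _ _ cvgF.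
rewrite integral_cst // mul1e in cvgF.
apply: cvge_le cvgF; exists m => // n /= mn.
apply: le_trans (E_nonincreasing ta0 mn).
apply: ge0_subset_integral => //; first exact: measurable_exp.
by move=> w _; rewrite lee_fin expR_ge0.
Qed.

Let G m (k : nat) : set Omega :=
  [set w | exists2 u, u \in level m & k%:R * path_label u w < 1].

Let mG m k : measurable (G m k).
Proof.
rewrite (_ : G m k = \bigcup_(u in [set` level m])
    ((fun w => k%:R * path_label u w) @^-1` `]-oo, 1[)).
  apply: fin_bigcup_measurable => [|u _]; first exact: finite_seq.
  have mX : measurable_fun setT (fun w => k%:R * path_label u w).
    by apply: measurable_funM => //; exact: measurable_path_label.
  by rewrite -[X in measurable X]setTI; exact: mX.
by apply/seteqP; split=> w /= [u um]; rewrite ?in_itv /= => h1; exists u => //=;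
  rewrite ?in_itv //=; move: h1; rewrite ?in_itv.
Qed.

Let prob_G_cvg0 m : P (G m k) @[k --> \oo] --> 0%E.
Proof.
have [] // := @dominated_convergence _ _ _ P setT measurableT
  (fun k w => (\1_(G m k) w)%:E) (cst 0%E) (cst 1%E).
- by move=> k; apply/measurable_EFinP; exact: measurable_indic.
- apply: filterS ae_path_label_gt0 => w X0 _; apply: cvg_near_cst.
  pose B := \sum_(u <- level m) (path_label u w)^-1.
  exists (Num.truncn B).+1 => // k /= Bk; rewrite indicE memNset //.
  move=> [u um]; apply/negP; rewrite -leNgt -ler_pdivrMr // div1r.
  apply: le_trans (_ : B <= _).
    rewrite /B (big_rem u) //= lerDl; apply: sumr_ge0 => v _.
    by rewrite invr_ge0 ltW.
  by rewrite ltW // (lt_le_trans (truncnS_gt _)) // ler_nat.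
- exact: finite_measure_integrable_cst.
- by apply: aeW => w k _; rewrite gee0_abs lee_fin indicE ?ler0n // lern1 leq_b1.
move=> _ _; rewrite integral_cst // mul0e.
rewrite (_ : (fun k => \int[P]_(w in setT) (\1_(G m k) w)%:E)%E =
  (fun k => P (G m k))) //.
by apply/funext => k; rewrite integral_indic // setIT.
Qed.

(** Outside [G m k] the scale [k] makes all labels of level [m] at least 1, so
    that every vertex contributes at least [de]. *)
Let E_le m k : (E k.+1%:R m <= (expR (- (de * (b ^ m)%:R)))%:E + P (G m k.+1))%E.
Proof.
have ta0 : 0 < k.+1%:R :> R by rewrite ltr0n.
pose rhs w : \bar R := ((expR (- (de * (b ^ m)%:R)))%:E + (\1_(G m k.+1) w)%:E)%E.
have -> : ((expR (- (de * (b ^ m)%:R)))%:E + P (G m k.+1))%E = (\int[P]_w rhs w)%E.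
  rewrite ge0_integralD //; last first.
    by apply/measurable_EFinP; exact: measurable_indic.
  by rewrite integral_probability_cst integral_indic // setIT.
apply: ae_ge0_le_integral => //.
- by move=> w _; rewrite adde_ge0 // lee_fin ?expR_ge0 // indicE ler0n.
- apply: emeasurable_funD => //; apply/measurable_EFinP; exact: measurable_indic.
apply: filterS ae_path_label_gt0 => w X0 _.
rewrite /rhs -EFinD lee_fin indicE.
case: (boolP (w \in _)) => [_|wG] /=.
  rewrite -[leLHS]add0r lerD ?expR_ge0 //.
  by rewrite -expR0 ler_expR oppr_le0 level_sum_scaled_ge0.
have -> : de * (b ^ m)%:R = \sum_(v <- level m) de.
  by rewrite big_const_seq count_predT iter_addr_0 size_level mulr_natr.
rewrite addr0 ler_expR lerN2.
rewrite /level_sum big_seq [leRHS]big_seq; apply: ler_sum => v vm.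
apply: h_ge; rewrite leNgt; apply: contra wG => lt1.
by rewrite inE; exists v.
Qed.

(** The scale first tends to infinity, which removes the exceptional event [G],
    and then the level [m]: each vertex of level [m] is an independent chance for
    the sum to diverge. *)
Lemma supercritical_infinite : {ae P, forall w, total_sum zeta w = +oo%E}.
Proof.
have PF m : (P F <= (expR (- (de * (b ^ m)%:R)))%:E)%E.
  have lim : (expR (- (de * (b ^ m)%:R)))%:E + P (G m k.+1) @[k --> \oo] -->
      (expR (- (de * (b ^ m)%:R)))%:E.
    rewrite -[X in _ --> X]adde0; apply: cvgeD => //; first exact: cvg_cst.
    by rewrite (cvg_shiftS (fun k => P (G m k))); exact: prob_G_cvg0.
  apply: cvge_ge lim; apply: nearW => k; apply: le_trans (E_le m k).
  by apply: prob_finite_le; rewrite ltr0n.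
have PF0 : P F = 0%E.
  have Pfin : P F \is a fin_num by exact: fin_num_measure.
  apply/eqP; rewrite eq_le measure_ge0 andbT -(fineK Pfin) lee_fin leNgt.
  apply/negP => p0; set p := fine (P F) in p0.
  have pm m : p * (1 + de * m%:R) <= 1.
    have : p <= expR (- (de * m%:R)).
      rewrite -lee_fin fineK // (le_trans (PF m)) // lee_fin ler_expR lerN2.
      by rewrite ler_pM2l // ler_nat ltnW // ltn_expl.
    move=> h1; rewrite -[leRHS](expRxMexpNx_1 (de * m%:R)) mulrC.
    apply: ler_pM => //; [|exact: ltW|exact: expR_ge1Dx].
    by rewrite addr_ge0 // mulr_ge0 // ltW.
  have := pm (Num.truncn (p * de)^-1).+1; rewrite leNgt => /negP; apply.
  have pde : 0 < p * de by rewrite mulr_gt0.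
  have := truncnS_gt (p * de)^-1; rewrite -(ltr_pM2l pde) mulfV ?gt_eqF //.
  by rewrite mulrDr mulr1 mulrA; lra.
have : {ae P, forall w, ~ F w} by exists F; split=> // w /= /contrapT.
move=> aeF; apply: filterS3 aeF ae_path_label_gt0 ae_path_product.
move=> w nF X0 pX.
have Yoo : Y w = +oo%E by apply: contrapT.
rewrite /total_sum (eq_esum (b := fun v => (path_label v w)%:E)); last first.
  by move=> v _; rewrite pX.
apply/eqP; rewrite -leye_eq -Yoo; apply: lime_le.
  by apply: is_cvg_nneseries => n _ _; rewrite lee_fin.
apply: nearW => N; apply: le_trans (level_sums_le_esum N (fun v => path_label v w)).
rewrite big_mkord sumEFin lee_fin; apply: ler_sum => n _; apply: ler_sum => v _.
by rewrite ger0_norm // ltW.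
Qed.

End Supercritical.

End LabelledTree.

Lemma moment0 {R : realType} {d' : measure_display} {Omega' : measurableType d'}
    {P' : probability Omega' R} {b : nat} (xi : 'I_b -> 'I_b -> Omega' -> R) i j :
  moment P' xi 0 i j = 1%E.
Proof.
rewrite /moment unlock (eq_integral (cst 1%E)); last by move=> x _; rewrite powRr0.
exact: integral_probability_cst.
Qed.

(** The exponent 0 is excluded because all entries of its moment matrix are 1, so
    that the vector [x] could not be decreased. *)
Lemma subcritical_exponent {R : realType} {d' : measure_display}
    {Omega' : measurableType d'} {P' : probability Omega' R} {b : nat}
    (xi : 'I_b -> 'I_b -> {RV P' >-> R}) : (0 < b)%N ->
  (lambda1 P' xi < 1)%E -> exists s th (x : 'I_b -> R),
  [/\ 0 < s <= 1, 0 <= th < 1, forall i, 0 < x i,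
    forall i j, (moment P' xi s i j < +oo)%E &
    forall i, \sum_j fine (moment P' xi s i j) * x j <= th * x i].
Proof.
move=> b0 /ereal_inf_lt[_ [s /= s01 <-]]; rewrite /rho.
case: asboolP => // hs; rewrite lte_fin /largest_eigenvalue => lt1.
have M0 i j : 0 <= moment_mx P' xi s i j.
  rewrite mxE; apply/fine_ge0; rewrite /moment unlock; apply: integral_ge0 => x _.
  by rewrite lee_fin powR_ge0.
have ev1 a : eigenvalue (moment_mx P' xi s) a -> a < 1.
  move=> ea; apply: le_lt_trans lt1; apply: ub_le_sup => //.
  by exists (\sum_i \sum_j `|moment_mx P' xi s i j|) => a' /=; exact: eigenvalue_bounded.
have [x x0 [th th01 sub]] := subinvariant_vector b0 M0 ev1.
have sub' i : \sum_j fine (moment P' xi s i j) * x j <= th * x i.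
  by apply: le_trans (sub i); apply: ler_sum => j _; rewrite mxE.
move: s01; rewrite in_itv /= => /andP[s0 s1].
exists s, th, x; split=> //; rewrite s1 andbT lt_neqAle s0 andbT.
apply/eqP => e; pose i := Ordinal b0; have := sub' i.
have [_ th1] := andP th01.
rewrite -e (bigD1 i) //= moment0 mul1r => h.
have : 0 <= \sum_(j < b | j != i) fine (moment P' xi 0 i j) * x j.
  by apply: sumr_ge0 => j _; rewrite moment0 mul1r ltW.
have : th * x i < x i by rewrite gtr_pMl.
by lra.
Qed.

Theorem theorem1 (R : realType) (b : nat) (hb : (2 <= b)%N)
    (d' : measure_display) (Omega' : measurableType d')
    (P' : probability Omega' R)
    (xi : 'I_b -> 'I_b -> {RV P' >-> R})
    (xi_gt0 : forall i j, {ae P', forall x, 0 < xi i j x})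
    (d : measure_display) (Omega : measurableType d)
    (P : probability Omega R)
    (c0 : 'I_b) (c : vertex b -> Omega -> 'I_b)
    (hc : random_colouring P c0 c)
    (zeta : vertex b -> {RV P >-> R})
    (hzeta : edge_variables_law P P' xi c zeta) :
  ((lambda1 P' xi < 1)%E ->
     {ae P, forall w, (total_sum zeta w < +oo)%E})
  /\
  ((1 < lambda1 P' xi)%E ->
   `[0, 1] `<=` moment_domain P' xi ->
   interior (moment_domain P' xi) 0 ->
   (forall i j, ('E_P'[fun x => (`|ln (xi i j x)|)%R] < +oo)%E) ->
   (forall i j, ('E_P'[fun x => (`|xi i j x * ln (xi i j x)|)%R] < +oo)%E) ->
     {ae P, forall w, total_sum zeta w = +oo%E}).
Proof.
split=> [l1|l1 hD _ _ _].
  have b0 : (0 < b)%N by exact: ltn_trans hb.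
  have [s [th [x [s01 th01 x0 fin sub]]]] := subcritical_exponent b0 l1.
  exact: (subcritical_finite hc hzeta xi_gt0 s01 th01 x0 fin sub).
have [h [mh [C hC] [de de0 hde] hbr]] := exists_subsolution xi_gt0 hD c0 l1.
exact: (supercritical_infinite hc hzeta xi_gt0 hb mh hC de0 hde hbr).
Qed.
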